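(* There exists a constant $\varepsilon>0$ such that, with $q_n:=\mathbb{E}\,Q_n$ and with $f$ the continuous probability density function of $Q$, we have $$\mathbb{P}(Q_n=x)=n^{-1}f\bigl((x-q_n)/n\bigr)+O(n^{-1-\varepsilon})$$ uniformly in integers $x$ (that is, the implicit constant in the $O(\cdot)$ term depends on neither $n$ nor $x$).
   Context: QuickSort: the input is a list of $n\ge 0$ distinct real numbers. If $n\in\{0,1\}$, do nothing. Otherwise pick an element of the list uniformly at random as the pivot, compare each of the other $n-1$ elements with the pivot, and recursively (with fresh independent randomness) sort the two resulting sublists. $Q_n$ denotes the total number of comparisons used in sorting a list of $n$ distinct items. Equivalently, $Q_0=Q_1=0$ and for $n\ge2$, $Q_n$ has the distribution of $Q_{U_n-1}+Q^*_{n-U_n}+n-1$, where $U_n$ is uniform on $\{1,\dots,n\}$, $Q_j^*$ has the distribution of $Q_j$, and all variables on the right are independent. It is known (R\'egnier, R\''osler) that $(Q_n-\mathbb{E}\,Q_n)/n$ converges in distribution as $n\to\infty$ to a random variable $Q$, and (Fill and Janson) that $Q$ has a continuous, strictly positive density $f$ on $\mathbb{R}$. *)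

(* Defs.v *)
From HB Require Import structures.
From mathcomp Require Import all_boot all_order all_algebra finmap.
From mathcomp Require Import all_classical all_reals all_analysis.

Set Implicit Arguments.
Unset Strict Implicit.
Unset Printing Implicit Defensive.

Import Order.TTheory GRing.Theory Num.Theory.
Import numFieldNormedType.Exports.

Local Open Scope classical_set_scope.
Local Open Scope ring_scope.

(* Equality in law is required on measurable sets only: the value of a measure
   on a non-measurable set carries no information. *)
Definition same_law d1 d2 d3 (T1 : measurableType d1) (T2 : measurableType d2)
    (S : measurableType d3) (R : realType) (P1 : probability T1 R)
    (P2 : probability T2 R) (X1 : T1 -> S) (X2 : T2 -> S) : Prop :=
  forall E : set S, measurable E -> P1 (X1 @^-1` E) = P2 (X2 @^-1` E).

Definition mutually_independent d (T : measurableType d) (R : realType)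
    (P : probability T R) (I : choiceType) (F : I -> set_system T) : Prop :=
  forall (J : {fset I}) (E : I -> set T),
    (forall i, i \in J -> F i (E i)) ->
    fine (P (\bigcap_(i in [set` J]) E i)) = \prod_(i <- J) fine (P (E i)).

Definition generated_events d d' (T : measurableType d) (S : measurableType d')
    (X : T -> S) : set_system T :=
  preimage_set_system setT X measurable.

(* The law of [Q n] is that of [Q_(U-1) + Q^*_(n-U) + n - 1], where [U] is
   uniform on [{1, ..., n}] and [U], [Q_0, ..., Q_(n-1)],
   [Q^*_0, ..., Q^*_(n-1)] are independent; below [A j] and [B j] are the
   copies [Q_j] and [Q^*_j], which may live on another probability space than
   the original variables. *)
Definition quicksort_step d (T : measurableType d) (R : realType)
    (P : probability T R) (Q : nat -> {RV P >-> R}) (n : nat) : Prop :=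
  exists (d' : measure_display) (T' : measurableType d')
    (P' : probability T' R) (U : {RV P' >-> nat})
    (A : nat -> {RV P' >-> R}) (B : nat -> {RV P' >-> R}),
  [/\ forall k : nat, (1 <= k <= n)%N ->
        P' (U @^-1` [set k]) = (n%:R^-1)%:E,
      forall j : nat, (j < n)%N ->
        same_law P P' (Q j) (A j) /\ same_law P P' (Q j) (B j),
      mutually_independent P' (fun i : option ('I_n + 'I_n) =>
        match i with
        | None => generated_events U
        | Some (inl j) => generated_events (A j)
        | Some (inr j) => generated_events (B j)
        end) &
      same_law P P' (Q n)
        (fun w => A (U w - 1)%N w + B (n - U w)%N w + (n - 1)%:R)].

(* Only the law of each individual [Q n] is prescribed; the joint law of the
   sequence is irrelevant. *)
Definition quicksort_comparisons d (T : measurableType d) (R : realType)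
    (P : probability T R) (Q : nat -> {RV P >-> R}) : Prop :=
  [/\ {ae P, forall w, Q 0%N w = 0}, {ae P, forall w, Q 1%N w = 0} &
      forall n : nat, (2 <= n)%N -> quicksort_step Q n].

Definition mean d (T : measurableType d) (R : realType)
    (P : probability T R) (X : {RV P >-> R}) : R := fine ('E_P[X])%E.

Definition cvg_in_distribution d d' (T : measurableType d)
    (T' : measurableType d') (R : realType) (P : probability T R)
    (P' : probability T' R) (Y : nat -> T -> R) (X : {RV P' >-> R}) : Prop :=
  forall t : R, {for t, continuous (cdf X)} ->
    P (Y n @^-1` `]-oo, t]) @[n --> \oo] --> cdf X t.

Definition is_density d (T : measurableType d) (R : realType)
    (P : probability T R) (X : {RV P >-> R}) (f : R -> R) : Prop :=
  [/\ measurable_fun setT f, forall x, 0 <= f x &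
      forall E : set R, measurable E ->
        P (X @^-1` E) = (\int[lebesgue_measure]_(x in E) (f x)%:E)%E].

(* Main.v *)
Require Import Defs.
From HB Require Import structures.
From mathcomp Require Import all_boot all_order all_algebra.
From mathcomp Require Import all_classical all_reals all_analysis.
From mathcomp Require Import measurable_realfun complex finmap.
From mathcomp Require Import ring lra zify.
Import Order.TTheory GRing.Theory Num.Theory.
Import numFieldNormedType.Exports.
Local Open Scope classical_set_scope.
Local Open Scope ring_scope.
(* Let [phi_n] be the characteristic function of [Q_n] and [q_n] its mean.  Two estimates
   on [phi_n] suffice.

   Decay.  Taking moduli in the recursion, [a_n = |phi_n t|] satisfies
   [(n+1) a_(n+1) <= sum_(j <= n) a_j a_(n-j)].  Since [x^(n+1)] solves this with equality,
   any uniform gain [a_m <= 1 - delta] for [M <= m < 2M] propagates to exponential decay in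
   [n / M].  Such a gain holds with [M] of order [1 / |t|]: for small [t] because
   [(Q_m - q_m) / m] converges to a law with a density, hence charges two disjoint
   intervals; for the other [t] because [Q_3] is not constant.  Hence
   [|phi_n t| = O((1 + (n t)^2)^(-3))] for [|t| <= pi].

   Rate.  [Q_n] is the internal path length of a random binary search tree, and
   [(Q_n - q_n) / (n + 1)] is a martingale under insertion of keys whose [n]-th increment has
   second moment [O(n^(-3/2))].  So the characteristic functions of [(Q_n - q_n) / n] and
   [(Q_m - q_m) / m], for [n <= m], differ at [t] by [O((1 + t^2) n^(-1/2))].

   Finite Fourier inversion then shows that [n P(Q_n = x)] and [m P(Q_m = x')] differ by
   [O(n^(-1/4) + |y - y'|)], where [y] and [y'] are the rescaled points.  Summing over the
   [x'] with [y < y' <= y + h], letting [m] tend to infinity and then [h] to [0], replaces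
   the second quantity by [f y]. *)

Set Implicit Arguments.
Unset Strict Implicit.
Unset Printing Implicit Defensive.
(** * Subsolutions of the quadratic recursion *)

Section Decay.
Context {R : realType}.
Implicit Types (a : nat -> R).

Definition halving_subsolution a :=
  forall n, n.+1%:R * a n.+1 <= \sum_(j < n.+1) a j * a (n - j)%N.

Lemma sum_ord_indicator (n M : nat) (r : R) : 0 <= r ->
  \sum_(j < n) (if (j < M)%N then r else 0) <= M%:R * r.
Proof.
move=> r0; rewrite -big_mkcond /= sumr_const -[in leLHS]mulr_natl.
apply: ler_wpM2r => //; rewrite ler_nat.
rewrite cardE -(size_map (@nat_of_ord n)) -[leqRHS](size_iota 0).
apply: uniq_leq_size; first by rewrite map_inj_uniq ?enum_uniq //; exact: val_inj.
by move=> _ /mapP[j + ->]; rewrite mem_enum mem_iota.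
Qed.

Lemma sum_ord_indicator_rev (n M : nat) (r : R) : 0 <= r ->
  \sum_(j < n.+1) (if (n - j < M)%N then r else 0) <= M%:R * r.
Proof.
move=> r0; rewrite (reindex_inj rev_ord_inj) /=.
rewrite (eq_bigr (fun j : 'I_n.+1 => if (j < M)%N then r else 0)) => [|j _]; last first.
  by rewrite subSS subKn // leq_ord.
exact: sum_ord_indicator.
Qed.

(** Past the window, [j] and [n - j] cannot both be below [M], so each product has one factor at
    most [r] by induction, while the other is at most 1. *)
Lemma subsolution_le_from_window a (M : nat) (r : R) :
    (0 < M)%N -> (forall n, 0 <= a n <= 1) -> halving_subsolution a ->
    (forall m, (M <= m < M.*2)%N -> a m <= r) ->
  forall n, (M <= n)%N -> a n <= r.
Proof.
move=> M0 a01 arec aw; elim/ltn_ind => -[|n] IH Mn; first by lia.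
have [nM|nM] := ltnP n.+1 M.*2; first by apply: aw; rewrite Mn.
rewrite -(ler_pM2l (_ : 0 < n.+1%:R)) ?ltr0n//.
apply: le_trans (arec n) _.
rewrite mulr_natl -[in leRHS](card_ord n.+1) -sumr_const; apply: ler_sum => j _.
have /andP[a0 a1] := a01 j; have /andP[b0 b1] := a01 (n - j)%N.
have jn := ltn_ord j.
have [jM|jM] := ltnP j M.
  apply: le_trans (ler_piMl b0 a1) _; apply: IH; lia.
by apply: le_trans (ler_piMr a0 b1) _; apply: IH; lia.
Qed.

(** Products of two terms with indices at least [M] are at most [r ^ 2]. At most [2 M] products have
    an index below [M]; the other index is then at least [M], so these are still at most [r]. *)
Lemma subsolution_contract a (M : nat) (r : R) : 0 <= r ->
    (forall n, 0 <= a n <= 1) -> halving_subsolution a ->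
    (forall n, (M <= n)%N -> a n <= r) ->
  forall n, (M.*2 <= n)%N -> (0 < n)%N -> n%:R * a n <= r * (n%:R * r + M.*2%:R).
Proof.
move=> r0 a01 arec aM [//|n] Mn _; apply: le_trans (arec n) _.
have h (j : 'I_n.+1) : a j * a (n - j)%N <=
    r * r + (if (j < M)%N then r else 0) + (if (n - j < M)%N then r else 0).
  have /andP[a0 a1] := a01 j; have /andP[b0 b1] := a01 (n - j)%N.
  have jn := ltn_ord j.
  have rr0 : 0 <= r * r by rewrite mulr_ge0.
  have [jM|jM] := ltnP j M; have [kM|kM] := ltnP (n - j)%N M.
  - by exfalso; clear -Mn jM kM; lia.
  - by rewrite addr0 (le_trans (ler_piMl b0 a1))// (le_trans (aM _ kM))// lerDr.
  - by rewrite addr0 (le_trans (ler_piMr a0 b1))// (le_trans (aM _ jM))// lerDr.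
  - by rewrite !addr0 ler_pM// aM.
apply: le_trans (ler_sum _ (fun j _ => h j)) _; rewrite !big_split /=.
rewrite sumr_const card_ord -[X in X + _ + _]mulr_natl.
have := @sum_ord_indicator n.+1 M r r0.
have := @sum_ord_indicator_rev n M r r0.
rewrite -addnn natrD; nra.
Qed.

(** Multiplying the threshold [L] by [K] gains a factor [1 - d / 2]: past [K L] the contraction
    factor [r + 2 L / n] is at most [(1 - d) + 2 / K], and [2 / K <= d / 2]. *)
Lemma subsolution_geometric a (M K : nat) (d : R) : (0 < M)%N ->
    0 < d < 1 -> 4 <= d * K%:R ->
    (forall n, 0 <= a n <= 1) -> halving_subsolution a ->
    (forall m, (M <= m < M.*2)%N -> a m <= 1 - d) ->
  forall i n, (K ^ i * M <= n)%N -> a n <= (1 - d / 2) ^+ i.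
Proof.
move=> M0 d01 dK a01 arec aw.
have aM := @subsolution_le_from_window a M (1 - d) M0 a01 arec aw.
have K4 : (4 <= K)%N by rewrite -(ler_nat R); nra.
elim=> [|i IH] n; first by rewrite expr0; have /andP[] := a01 n.
set L := (K ^ i * M)%N in IH *; rewrite expnS -mulnA -/L => Ln.
have ML : (M <= L)%N by rewrite leq_pmull// expn_gt0; lia.
(* The bound [1 - d] is kept beside the inductive one: it controls the contraction factor already at
   [i = 0], where the inductive bound is only 1. *)
pose r := Num.min ((1 - d / 2) ^+ i) (1 - d).
have r0 : 0 <= r.
  rewrite le_min; apply/andP; split; last by lra.
  by apply: exprn_ge0; lra.
have n0 : (0 < n)%N by nia.
have /(_ _ n _ n0) := @subsolution_contract a L r r0 a01 arec.
have aLr m : (L <= m)%N -> a m <= r.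
  by move=> Lm; rewrite le_min IH// aM// (leq_trans ML).
move=> /(_ aLr (ltac:(nia))) h.
rewrite -(ler_pM2l (_ : 0 < n%:R)) ?ltr0n//; apply: le_trans h _.
rewrite exprS mulrA [leRHS]mulrC; apply: ler_pM => //.
- by rewrite addr_ge0// mulr_ge0.
- by rewrite ge_min lexx.
- have rd : r <= 1 - d by rewrite ge_min lexx orbT.
  have n0' : (0 : R) < n%:R by rewrite ltr0n.
  have Ln' : K%:R * L%:R <= n%:R :> R by rewrite -natrM ler_nat.
  have L0 : 0 <= L%:R :> R by [].
  rewrite -addnn natrD; nra.
Qed.

(** Strong induction. Up to [16 L] the claimed bound is still at least [1/8], by Bernoulli. Beyond,
    products with both indices at least [L] are at most [rho ^ n / 16], and the at most [2 L] others
    are too few to spoil the gain. *)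
Lemma subsolution_exponential a (L : nat) : (0 < L)%N ->
    (forall n, 0 <= a n <= 1) -> halving_subsolution a ->
    (forall n, (L <= n)%N -> a n <= 8^-1) ->
  forall n, (L <= n)%N -> a n <= (1 - (32 * L%:R)^-1) ^+ n / 4.
Proof.
move=> L0 a01 arec aL.
set x := (32 * L%:R)^-1; set rho := 1 - x.
have L1 : 1 <= L%:R :> R by rewrite ler1n.
have xL : x * L%:R = 32^-1 by rewrite /x; field; rewrite pnatr_eq0; lia.
have x0 : 0 < x by nra.
have x1 : x <= 32^-1 by nra.
have rho0 : 0 < rho by rewrite /rho; lra.
have rho1 : rho <= 1 by rewrite /rho; lra.
have bern k : 1 - k%:R * x <= rho ^+ k.
  elim: k => [|k IH]; first by rewrite expr0; lra.
  rewrite exprS -natr1; have : 0 <= k%:R :> R by [].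
  have rk0 : 0 <= rho ^+ k by rewrite exprn_ge0// ltW.
  have rk1 : rho ^+ k <= 1 by rewrite exprn_ile1// ltW.
  rewrite /rho in rk0 rk1 IH *; nra.
have hrho j : (j < L)%N -> rho ^+ j.+1 >= 31 / 32.
  move=> jL; apply: le_trans (bern _).
  have : j.+1%:R <= L%:R :> R by rewrite ler_nat.
  nra.
elim/ltn_ind => -[|n] IH Ln; first by lia.
have [nL|nL] := leqP n.+1 (16 * L).
  apply: le_trans (aL _ Ln) _.
  have : n.+1%:R <= 16 * L%:R :> R by rewrite -natrM ler_nat.
  have := bern n.+1; nra.
rewrite -(ler_pM2l (_ : 0 < n.+1%:R)) ?ltr0n//; apply: le_trans (arec n) _.
set q := rho ^+ n.+1.
have q0 : 0 < q by rewrite exprn_gt0.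
have hq j : (j < L)%N -> (j <= n)%N -> rho ^+ (n - j)%N <= q * (32 / 31).
  move=> jL jn; have := hrho _ jL.
  have -> : q = rho ^+ (n - j) * rho ^+ j.+1 by rewrite -exprD /q; congr (_ ^+ _); lia.
  have : 0 < rho ^+ (n - j) by rewrite exprn_gt0.
  nra.
(* The coefficients are [1/16] and [1/4] times [32/31], which bounds the loss from replacing the
   exponent by [n.+1]. As [16 L <= n.+1], they sum to at most [(2/31 + 1/31) q] per term, below
   [q / 4]. *)
have h (j : 'I_n.+1) : a j * a (n - j)%N <=
    (2 / 31) * q + (if (j < L)%N then 8 / 31 * q else 0)
                 + (if (n - j < L)%N then 8 / 31 * q else 0).
  have /andP[a0 a1] := a01 j; have /andP[b0 b1] := a01 (n - j)%N.
  have jn : (j <= n)%N by rewrite -ltnS.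
  have [jM|jM] := ltnP j L; have [kM|kM] := ltnP (n - j)%N L.
  - by exfalso; clear -nL jM kM; lia.
  - have := IH (n - j)%N (leq_subr _ _ : (n - j < n.+1)%N) kM.
    have := hq j jM jn; clear -a0 a1 b0 b1; nra.
  - have := IH j (ltn_ord j) jM; have := hq (n - j)%N kM (leq_subr _ _).
    rewrite subKn//; clear -a0 a1 b0 b1; nra.
  - have h1 := IH j (ltn_ord j) jM.
    have h2 := IH (n - j)%N (leq_subr _ _ : (n - j < n.+1)%N) kM.
    apply: le_trans (ler_pM a0 b0 h1 h2) _.
    have := hrho 0%N L0; rewrite expr1.
    have -> : rho ^+ j / 4 * (rho ^+ (n - j)%N / 4) = rho ^+ n / 16.
      by rewrite -[in RHS](subnKC jn) exprD; field.
    have -> : q = rho * rho ^+ n by rewrite /q exprS.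
    have : 0 < rho ^+ n by rewrite exprn_gt0.
    nra.
apply: le_trans (ler_sum _ (fun j _ => h j)) _; rewrite !big_split /=.
rewrite sumr_const card_ord -[X in X + _ + _]mulr_natl.
have q8 : 0 <= 8 / 31 * q by nra.
have := @sum_ord_indicator n.+1 L _ q8.
have := @sum_ord_indicator_rev n L _ q8.
have : 16 * L%:R <= n.+1%:R :> R by rewrite -natrM ler_nat; lia.
nra.
Qed.

(** The constant depends on [d] and [C0] only. The number [i] of contractions that reach [1/8] is
    fixed, so [L = K ^ i * M] is comparable to [M] and the exponential rate [1 / (32 L)] is at least
    a fixed multiple of [theta]. *)
Lemma subsolution_decay (d C0 : R) : 0 < d < 1 -> 0 < C0 ->
  exists C : R, forall a (M : nat) (theta : R), 0 <= theta ->
    (0 < M)%N -> M%:R * theta <= C0 ->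
    (forall n, 0 <= a n <= 1) -> halving_subsolution a ->
    (forall m, (M <= m < M.*2)%N -> a m <= 1 - d) ->
  forall n, a n * (1 + (n%:R * theta) ^+ 2) ^+ 3 <= C.
Proof.
move=> d01 C00.
have [K dK] : exists K : nat, 4 <= d * K%:R.
  exists (Num.bound (4 / d)); have := archi_boundP (_ : 0 <= 4 / d).
  have d0 : 0 < d by lra.
  rewrite ltr_pdivrMr// => h; rewrite mulrC ltW// h//.
  by rewrite divr_ge0// ltW.
have [i hi] : exists i : nat, (1 - d / 2) ^+ i <= 8^-1.
  have := @cvg_expr R (1 - d / 2); rewrite ger0_norm; last by lra.
  move=> /(_ (ltac:(lra))) /cvgr_le /(_ 8^-1) h.
  have [] := h; first by lra.
  by move=> N _ hN; exists N; apply: hN => /=.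
pose B := (K ^ i)%N%:R * C0.
pose A := 32 * B.
pose D : R := 4 * (1 + A ^+ 6 * 6`!%:R).
(* The first summand serves [n < L], where [n * theta <= B]; [D] serves [n >= L], where the
   exponential beats the sixth power. *)
exists ((1 + B ^+ 2) ^+ 3 + D).
move=> a M theta th0 M0 MC a01 arec aw n.
have KM := @subsolution_geometric a M K d M0 d01 dK a01 arec aw i.
set L := (K ^ i * M)%N in KM.
have K0 : (0 < K)%N by rewrite -(ltr_nat R); nra.
have L0 : (0 < L)%N by rewrite muln_gt0 expn_gt0 K0.
have B0 : 0 <= B by rewrite mulr_ge0// ltW.
have A0 : 0 <= A by rewrite mulr_ge0.
have D0 : 0 <= D by rewrite mulr_ge0// addr_ge0// mulr_ge0// exprn_ge0.
have aL m : (L <= m)%N -> a m <= 8^-1 by move=> Lm; exact: le_trans (KM m Lm) hi.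
have LB : L%:R * theta <= B by rewrite natrM -mulrA ler_wpM2l.
set t := n%:R * theta; have t0 : 0 <= t by rewrite mulr_ge0.
have [nL|nL] := ltnP n L.
  have tB : t <= B.
    by apply: le_trans LB; rewrite ler_wpM2r// ler_nat ltnW.
  have /andP[a0 a1] := a01 n.
  apply: le_trans (ler_piMl _ a1) _; first by rewrite exprn_ge0// addr_ge0// sqr_ge0.
  apply: ler_wpDr => //.
  by rewrite lerXn2r ?nnegrE ?addr_ge0 ?sqr_ge0// lerD2l lerXn2r.
apply: ler_wpDl; first by rewrite exprn_ge0// addr_ge0 ?sqr_ge0.
have := @subsolution_exponential a L L0 a01 arec aL n nL.
set y := (32 * L%:R)^-1 => hn.
have y0 : 0 < y by rewrite invr_gt0 mulr_gt0 ?ltr0n.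
have yL : y * L%:R = 32^-1 by rewrite /y; field; rewrite pnatr_eq0 -lt0n.
have y1 : 0 <= 1 - y.
  have : 1 <= L%:R :> R by rewrite ler1n.
  by clear -y0 yL; nra.
pose u := n%:R * y.
have u0 : 0 <= u by rewrite mulr_ge0 // ltW.
have {}hn : a n <= expR (- u).
  apply: le_trans hn _; apply: (@le_trans _ _ ((1 - y) ^+ n)).
    by rewrite ler_pdivrMr// ler_peMr ?exprn_ge0// ler1n.
  rewrite -mulrN expRM_natl; apply: lerXn2r; rewrite ?nnegrE ?expR_ge0//.
  by apply: le_trans (expR_ge1Dx _).
have tA : t <= A * u.
  have -> : A * u = 32 * y * n%:R * B by rewrite /A /u; ring.
  apply: le_trans (_ : 32 * y * n%:R * (L%:R * theta) <= _).
    have -> : 32 * y * n%:R * (L%:R * theta) = 32 * (y * L%:R) * t by rewrite /t; ring.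
    by rewrite yL mulfV// mul1r.
  by rewrite ler_wpM2l// !mulr_ge0// ltW.
have t6 : t ^+ 6 <= A ^+ 6 * u ^+ 6 by rewrite -exprMn lerXn2r// nnegrE mulr_ge0.
have eu := @expR_ge1Dxn R u 5 u0.
apply: le_trans (ler_wpM2r _ hn) _; first by rewrite exprn_ge0// addr_ge0 ?sqr_ge0.
rewrite expRN mulrC ler_pdivrMr ?expR_gt0//.
have h3 (s : R) : 0 <= s -> (1 + s) ^+ 3 <= 4 * (1 + s ^+ 3).
  move=> s0; rewrite -subr_ge0.
  have -> : 4 * (1 + s ^+ 3) - (1 + s) ^+ 3 = 3 * ((1 + s) * (1 - s) ^+ 2) by ring.
  by apply: mulr_ge0 => //; apply: mulr_ge0; [exact: addr_ge0 | exact: sqr_ge0].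
apply: le_trans (h3 _ (sqr_ge0 t)) _; rewrite -exprM /D -mulrA ler_wpM2l//.
have F0 : 0 < (6`!%:R : R) by rewrite ltr0n fact_gt0.
have u6 : u ^+ 6 <= 6`!%:R * expR u.
  by rewrite mulrC -ler_pdivrMr//; apply: le_trans eu; rewrite lerDr.
have e1 : 1 <= expR u by rewrite (le_trans _ (expR_ge1Dx u))// lerDl.
rewrite mulrDl mul1r; apply: lerD => //; apply: le_trans t6 _; rewrite -[leRHS]mulrA.
by apply: ler_wpM2l => //; exact: exprn_ge0.
Qed.
End Decay.
(** * Finitely supported laws and the law of the number of comparisons *)

Section StrongRecursion.
Variables (A : Type) (a0 : A) (step : nat -> (nat -> A) -> A).

(** Course-of-values recursion: the list stores the values up to [n], so [step] may consult all of
    them. [a0] is both the value at 0 and the default past the end of the list. *)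
Fixpoint history n : seq A :=
  if n is m.+1 then rcons (history m) (step m (nth a0 (history m))) else [:: a0].

Definition strong_rec n := nth a0 (history n) n.

Lemma size_history n : size (history n) = n.+1.
Proof. by elim: n => //= n IH; rewrite size_rcons IH. Qed.

Lemma nth_history m n : (m <= n)%N -> nth a0 (history n) m = strong_rec m.
Proof.
elim: n => [|n IH]; first by case: m.
rewrite leq_eqVlt => /predU1P[->//|]; rewrite ltnS => mn.
by rewrite /= nth_rcons size_history ltnS mn IH.
Qed.

Lemma strong_recS n :
    (forall f g, (forall m, (m <= n)%N -> f m = g m) -> step n f = step n g) ->
  strong_rec n.+1 = step n strong_rec.
Proof.
move=> ext; rewrite /strong_rec /= nth_rcons size_history ltnn eqxx.
by apply: ext => m mn; rewrite nth_history.
Qed.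

End StrongRecursion.

(** * Weighted means over finite lists *)

Section WeightedMean.
Context {R : realType}.

(** A list of weighted points stands for a finitely supported measure, repetitions allowed. Values
    lie in a module so that real and complex integrands are treated together. *)
Definition wmean (V : lmodType R) (T : Type) (mu : seq (R * T)) (F : T -> V) : V :=
  \sum_(p <- mu) p.1 *: F p.2.

Definition rmean (T : Type) (mu : seq (R * T)) (F : T -> R) : R :=
  wmean (V := R^o) mu F.

Definition nonneg_weights (T : Type) (mu : seq (R * T)) := all (fun p => 0 <= p.1) mu.

Section Linear.
Variables (T : Type) (mu : seq (R * T)) (V : lmodType R).
Implicit Types (F G : T -> V) (a : R).

Lemma rmeanE (f : T -> R) : rmean mu f = \sum_(p <- mu) p.1 * f p.2.
Proof. by []. Qed.

Lemma eq_wmean F G : F =1 G -> wmean mu F = wmean mu G.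
Proof. by move=> FG; apply: eq_bigr => p _; rewrite FG. Qed.

Lemma eq_wmean_all F G (P : pred T) : all (fun p => P p.2) mu ->
  (forall x, P x -> F x = G x) -> wmean mu F = wmean mu G.
Proof.
move=> + FG; rewrite /wmean; elim: mu => [|p s IH] /=; first by rewrite !big_nil.
by case/andP=> Pp Ps; rewrite !big_cons FG// IH.
Qed.

Lemma eq_rmean (f g : T -> R) : f =1 g -> rmean mu f = rmean mu g.
Proof. by move=> fg; apply: eq_bigr => p _; rewrite fg. Qed.

Lemma wmeanD F G : wmean mu (fun x => F x + G x) = wmean mu F + wmean mu G.
Proof. by rewrite -big_split; apply: eq_bigr => p _; rewrite scalerDr. Qed.

Lemma wmeanB F G : wmean mu (fun x => F x - G x) = wmean mu F - wmean mu G.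
Proof. by rewrite -sumrB; apply: eq_bigr => p _; rewrite scalerBr. Qed.

Lemma wmeanZ a F : wmean mu (fun x => a *: F x) = a *: wmean mu F.
Proof. by rewrite scaler_sumr; apply: eq_bigr => p _; rewrite !scalerA mulrC. Qed.

Lemma wmean_sum (I : Type) (r : seq I) (P : pred I) (F : I -> T -> V) :
  wmean mu (fun x => \sum_(i <- r | P i) F i x) = \sum_(i <- r | P i) wmean mu (F i).
Proof.
by rewrite exchange_big; apply: eq_bigr => p _; rewrite scaler_sumr.
Qed.

Lemma wmean_scale (f : T -> R) (v : V) :
  wmean mu (fun x => f x *: v) = rmean mu f *: v.
Proof. by rewrite rmeanE scaler_suml; apply: eq_bigr => p _; rewrite scalerA. Qed.

End Linear.

Lemma exchange_wmean (T U : Type) (V : lmodType R) (mu : seq (R * T))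
    (nu : seq (R * U)) (F : T -> U -> V) :
  wmean mu (fun x => wmean nu (F x)) = wmean nu (fun y => wmean mu (F^~ y)).
Proof. by rewrite wmean_sum; apply: eq_bigr => p _; rewrite wmeanZ. Qed.

Section Real.
Variables (T : Type) (mu : seq (R * T)).
Implicit Types (f g : T -> R) (a : R).

Lemma rmeanD f g : rmean mu (fun x => f x + g x) = rmean mu f + rmean mu g.
Proof. by rewrite !rmeanE -big_split; apply: eq_bigr => p _; rewrite mulrDr. Qed.

Lemma rmeanB f g : rmean mu (fun x => f x - g x) = rmean mu f - rmean mu g.
Proof. by rewrite !rmeanE -sumrB; apply: eq_bigr => p _; rewrite mulrBr. Qed.

Lemma rmeanZ a f : rmean mu (fun x => a * f x) = a * rmean mu f.
Proof. by rewrite !rmeanE mulr_sumr; apply: eq_bigr => p _; rewrite mulrCA. Qed.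

Lemma rmean_cst a : rmean mu (fun=> a) = rmean mu (fun=> 1) * a.
Proof. by rewrite !rmeanE mulr_suml; apply: eq_bigr => p _; rewrite mulr1. Qed.

Lemma rmean_sum (I : Type) (r : seq I) (P : pred I) (f : I -> T -> R) :
  rmean mu (fun x => \sum_(i <- r | P i) f i x) = \sum_(i <- r | P i) rmean mu (f i).
Proof. by rewrite /rmean wmean_sum. Qed.

Lemma ler_rmean f g : nonneg_weights mu -> (forall x, f x <= g x) ->
  rmean mu f <= rmean mu g.
Proof.
move=> + fg; rewrite !rmeanE; elim: mu => [|p s IH] /=; first by rewrite !big_nil.
by case/andP=> p0 s0; rewrite !big_cons lerD ?IH// ler_wpM2l.
Qed.

Lemma rmean_ge0 f : nonneg_weights mu -> (forall x, 0 <= f x) -> 0 <= rmean mu f.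
Proof.
move=> mu0 f0; have := ler_rmean (f := fun=> 0) mu0 f0.
by rewrite rmean_cst mulr0.
Qed.

End Real.

(** For probability weights and laws: the law of [g X Y], where [j] is drawn with weight [w j] and
    then [X] and [Y] independently from [mu j] and [nu (n - j)]. *)
Definition mixture (T U W : Type) (n : nat) (w : nat -> R)
    (mu : nat -> seq (R * T)) (nu : nat -> seq (R * U)) (g : T -> U -> W) : seq (R * W) :=
  flatten [seq [seq (w j * (p.1 * q.1), g p.2 q.2) | p <- mu j, q <- nu (n - j)%N]
          | j <- iota 0 n.+1].

Lemma wmean_mixture (T U W : Type) (V : lmodType R) n w
    (mu : nat -> seq (R * T)) (nu : nat -> seq (R * U)) (g : T -> U -> W) (F : W -> V) :
  wmean (mixture n w mu nu g) F =
  \sum_(j < n.+1) w j *: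
    wmean (mu j) (fun x => wmean (nu (n - j)%N) (fun y => F (g x y))).
Proof.
rewrite /wmean /mixture big_flatten big_map -[iota 0 n.+1]/(index_iota 0 n.+1) big_mkord.
apply: eq_bigr => j _; rewrite big_allpairs_dep /= scaler_sumr.
apply: eq_bigr => p _; rewrite !scaler_sumr; apply: eq_bigr => q _ /=.
by rewrite !scalerA mulrA.
Qed.

Lemma rmean_mixture (T U W : Type) n w
    (mu : nat -> seq (R * T)) (nu : nat -> seq (R * U)) (g : T -> U -> W) (f : W -> R) :
  rmean (mixture n w mu nu g) f =
  \sum_(j < n.+1) w j *
    rmean (mu j) (fun x => rmean (nu (n - j)%N) (fun y => f (g x y))).
Proof. exact: (wmean_mixture n w mu nu g (f : W -> R^o)). Qed.

Lemma eq_mixture (T U W : Type) n w (mu mu' : nat -> seq (R * T))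
    (nu nu' : nat -> seq (R * U)) (g : T -> U -> W) :
    (forall m, (m <= n)%N -> mu m = mu' m) -> (forall m, (m <= n)%N -> nu m = nu' m) ->
  mixture n w mu nu g = mixture n w mu' nu' g.
Proof.
move=> h h'; rewrite /mixture; congr flatten; apply/eq_in_map => j.
by rewrite mem_iota add0n ltnS => jn; rewrite h// h'// leq_subr.
Qed.

Lemma nonneg_weights_mixture (T U W : Type) n w
    (mu : nat -> seq (R * T)) (nu : nat -> seq (R * U)) (g : T -> U -> W) :
    (forall m, 0 <= w m) ->
    (forall m, (m <= n)%N -> nonneg_weights (mu m)) ->
    (forall m, (m <= n)%N -> nonneg_weights (nu m)) ->
  nonneg_weights (mixture n w mu nu g).
Proof.
move=> w0 h h'; rewrite /mixture; have : {in iota 0 n.+1, forall j, (j <= n)%N}.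
  by move=> j; rewrite mem_iota.
elim: (iota 0 n.+1) => //= j r IHr rn; rewrite /nonneg_weights all_cat.
rewrite [X in _ && X]IHr ?andbT => [|i ir]; last by apply: rn; rewrite inE ir orbT.
have jn : (j <= n)%N by apply: rn; rewrite inE eqxx.
have := h j jn; have := h' _ (leq_subr j n).
rewrite /nonneg_weights; elim: (mu j) => //= p s IH nu0 /andP[p0 s0].
rewrite all_cat IH// andbT all_map; elim: (nu _) nu0 => //= q t IHt /andP[q0 t0].
by rewrite IHt// andbT !mulr_ge0.
Qed.

End WeightedMean.

(** * The law of the number of comparisons and its coupling by insertion *)

Section QuicksortLaw.
Variable R : realType.

(** Among [n + 1] items, a pivot with [j] smaller items costs [n] comparisons and leaves sublists of
    sizes [j] and [n - j]. *)
Definition quicksort_law : nat -> seq (R * nat) :=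
  strong_rec [:: (1, 0%N)] (fun n law =>
    mixture n (fun=> n.+1%:R^-1) law law (fun x y => x + y + n)%N).

Lemma quicksort_lawS n : quicksort_law n.+1 =
  mixture n (fun=> n.+1%:R^-1) quicksort_law quicksort_law (fun x y => x + y + n)%N.
Proof. by rewrite [LHS]strong_recS// => f g fg; apply: eq_mixture. Qed.

(* The joint law of the cost of a random binary search tree with [n] keys and of the depth
   of the external node at which the next key is inserted.  In a tree with [n + 1] keys and
   subtrees of sizes [j] and [n - j], the new key enters the first one with probability
   [(j + 1) / (n + 2)]; the factor 2 accounts for the symmetric case. *)
Definition insertion_law : nat -> seq (R * (nat * nat)) :=
  strong_rec [:: (1, (0%N, 0%N))] (fun n law =>
    mixture n (fun j => 2 * j.+1%:R / (n.+1%:R * n.+2%:R)) law quicksort_law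
      (fun xd y => (xd.1 + y + n, xd.2.+1)%N)).

Lemma insertion_lawS n : insertion_law n.+1 =
  mixture n (fun j => 2 * j.+1%:R / (n.+1%:R * n.+2%:R)) insertion_law quicksort_law
      (fun xd y => (xd.1 + y + n, xd.2.+1)%N).
Proof. by rewrite [LHS]strong_recS// => f g fg; apply: eq_mixture. Qed.

Section Moments.
Variable V : lmodType R.
Implicit Types F : nat -> V.

Lemma wmean_quicksort_law0 F : wmean (quicksort_law 0) F = F 0%N.
Proof. by rewrite /wmean big_seq1 scale1r. Qed.

Lemma wmean_insertion_law0 (F : nat * nat -> V) :
  wmean (insertion_law 0) F = F (0, 0)%N.
Proof. by rewrite /wmean big_seq1 scale1r. Qed.

Definition split_mean n F j : V :=
  wmean (quicksort_law j) (fun x => wmean (quicksort_law (n - j)) (fun y => F (x + y)%N)).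

Lemma split_mean_rev n F j : (j <= n)%N -> split_mean n F (n - j) = split_mean n F j.
Proof.
move=> jn; rewrite /split_mean subKn// exchange_wmean.
by apply: eq_wmean => x; apply: eq_wmean => y; rewrite addnC.
Qed.

Lemma wmean_quicksort_lawS n F :
  wmean (quicksort_law n.+1) F =
  n.+1%:R^-1 *: \sum_(j < n.+1) split_mean n (fun x => F (x + n)%N) j.
Proof. by rewrite quicksort_lawS wmean_mixture scaler_sumr. Qed.

(* The two subtrees are exchangeable, so [c] may be replaced by its symmetrization. *)
Lemma sum_split_mean_symm n F (c : nat -> R) (s : R) :
    (forall j, (j <= n)%N -> c j + c (n - j)%N = s) ->
  \sum_(j < n.+1) c j *: split_mean n F j =
  (s / 2) *: \sum_(j < n.+1) split_mean n F j.
Proof.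
move=> cs; set S := LHS.
have -> : S = (2^-1 : R) *: (S + S).
  rewrite scalerDr -scalerDl.
  have -> : 2^-1 + 2^-1 = 1 :> R by lra.
  by rewrite scale1r.
rewrite {2}/S (reindex_inj rev_ord_inj) /= -big_split mulrC -scalerA; congr (_ *: _).
rewrite scaler_sumr; apply: eq_bigr => j _; have jn : (j <= n)%N := leq_ord j.
by rewrite /= subSS split_mean_rev// -scalerDl cs.
Qed.

(** The weights of [j] and [n - j] add up to [2 / (n + 1)], so symmetrization makes the size of the
    first subtree uniform. *)
Lemma wmean_insertion_cost n F :
  wmean (insertion_law n) (fun xd => F xd.1) = wmean (quicksort_law n) F.
Proof.
elim/ltn_ind: n F => -[|n] IH F; first by rewrite wmean_insertion_law0 wmean_quicksort_law0.
rewrite insertion_lawS wmean_mixture wmean_quicksort_lawS /=.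
pose c j : R := 2 * j.+1%:R / (n.+1%:R * n.+2%:R).
transitivity (\sum_(j < n.+1) c j *: split_mean n (fun x => F (x + n)%N) j).
  apply: eq_bigr => j _; congr (_ *: _).
  exact: (IH j (ltn_ord j) (fun x => wmean _ (fun y => F (x + y + n)%N))).
rewrite (@sum_split_mean_symm _ _ c (2 / n.+1%:R)) => [|j jn].
  by rewrite mulrAC mulfV// mul1r.
have nj : (n - j).+1%:R = n%:R - j%:R + 1 :> R by rewrite -natr1 natrB.
rewrite /c nj; field. by rewrite ?nat1r -?natrD !pnatr_eq0.
Qed.

(** The cost is the internal path length, which an insertion increases by the depth of the external
    node it fills. In the induction the weights become [2 j / ((n + 1) (n + 2))], [j] now counting
    the new key, and symmetrize to uniform ones. *)
Lemma wmean_insertion_succ n F :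
  wmean (insertion_law n) (fun xd => F (xd.1 + xd.2)%N) = wmean (quicksort_law n.+1) F.
Proof.
elim/ltn_ind: n F => -[|n] IH F.
  by rewrite wmean_insertion_law0 wmean_quicksort_lawS big_ord1 /split_mean
    !wmean_quicksort_law0 invr1 scale1r.
rewrite insertion_lawS wmean_mixture wmean_quicksort_lawS /=.
pose c j : R := 2 * j%:R / (n.+1%:R * n.+2%:R).
transitivity (\sum_(j < n.+2) c j *: split_mean n.+1 (fun x => F (x + n.+1)%N) j).
  (* A subtree that has received the new key is not empty; the missing term [j = 0] has weight 0. *)
  have c0 : c 0%N = 0 by rewrite /c mulr0n mulr0 mul0r.
  rewrite [RHS]big_ord_recl [c ord0]c0 scale0r add0r; apply: eq_bigr => j _.
  rewrite lift0; congr (_ *: _); rewrite /split_mean subSS.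
  rewrite -(IH j (ltn_ord j) (fun x => wmean _ (fun y => F (x + y + n.+1)%N))).
  by apply: eq_wmean => -[x d] /=; apply: eq_wmean => y; congr F; lia.
rewrite (@sum_split_mean_symm _ _ c (2 / n.+2%:R)) => [|j jn].
  by rewrite mulrAC mulfV// mul1r.
by rewrite /c natrB//; field; rewrite ?nat1r -?natrD !pnatr_eq0.
Qed.

(** The [n + 1] external nodes have total depth [x + 2 n], the external path length, and the new key
    goes to a uniform one of them. *)
Lemma wmean_insertion_depth n F :
  wmean (insertion_law n) (fun xd => xd.2%:R *: F xd.1) =
  wmean (quicksort_law n) (fun x => ((x + n.*2)%N%:R / n.+1%:R) *: F x).
Proof.
elim/ltn_ind: n F => -[|n] IH F.
  by rewrite wmean_insertion_law0 wmean_quicksort_law0 mul0r.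
rewrite insertion_lawS wmean_mixture /=.
pose G x : V := (x + n.+1.*2)%N%:R *: F x.
have -> : wmean (quicksort_law n.+1) (fun x => ((x + n.+1.*2)%N%:R / n.+2%:R) *: F x) =
    n.+2%:R^-1 *: wmean (quicksort_law n.+1) G.
  by rewrite -wmeanZ; apply: eq_wmean => x; rewrite scalerA mulrC.
rewrite wmean_quicksort_lawS scalerA.
(* The factor is [(j + 1) ((x + 2 j) / (j + 1) + 1)], the total depth of the external nodes in the
   first subtree. With its mirror image it gives [x + y + 3 n + 2], the new cost [x + y + n] plus
   [2 (n + 1)]. *)
pose H j : V := wmean (quicksort_law j) (fun x => wmean (quicksort_law (n - j)%N)
   (fun y => (x + 3 * j + 1)%N%:R *: F (x + y + n)%N)).
transitivity ((2 / (n.+1%:R * n.+2%:R) : R) *: \sum_(j < n.+1) H j).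
  rewrite scaler_sumr; apply: eq_bigr => j _.
  pose K x := wmean (quicksort_law (n - j)%N) (fun y => F (x + y + n)%N).
  transitivity ((2 * j.+1%:R / (n.+1%:R * n.+2%:R) : R) *:
     (wmean (insertion_law j) (fun xd => xd.2%:R *: K xd.1) +
      wmean (insertion_law j) (fun xd => K xd.1))).
    congr (_ *: _); rewrite -wmeanD; apply: eq_wmean => -[x d] /=.
    by rewrite wmeanZ -natr1 scalerDl scale1r.
  rewrite IH// wmean_insertion_cost -wmeanD -!wmeanZ; apply: eq_wmean => x.
  rewrite -[X in _ *: (_ + X)]scale1r -scalerDl scalerA wmeanZ scalerA; congr (_ *: _).
  rewrite -addnn !natrD; field; rewrite ?nat1r -?natrD !pnatr_eq0//.
have Hs j : (j <= n)%N -> H j + H (n - j)%N = split_mean n (fun x => G (x + n)%N) j.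
  move=> jn; rewrite /H subKn// [X in _ + X]exchange_wmean /split_mean -wmeanD.
  apply: eq_wmean => x; rewrite -wmeanD; apply: eq_wmean => y.
  rewrite [(y + x)%N]addnC -scalerDl /G -natrD; congr (_%:R *: _).
  by clear -jn; lia.
have -> : \sum_(j < n.+1) H j = (2^-1 : R) *: \sum_(j < n.+1) split_mean n (fun x => G (x + n)%N) j.
  rewrite -(eq_bigr _ (fun (j : 'I_n.+1) _ => Hs j (leq_ord j))) big_split /=.
  have -> : \sum_(j < n.+1) H (n - j)%N = \sum_(j < n.+1) H j.
    by rewrite [RHS](reindex_inj rev_ord_inj) /=; apply: eq_bigr => j _; rewrite subSS.
  rewrite scalerDr -scalerDl.
  have -> : 2^-1 + 2^-1 = 1 :> R by lra.
  by rewrite scale1r.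
rewrite scalerA; congr (_ *: _).
by field; rewrite ?nat1r -?natrD !pnatr_eq0.
Qed.
End Moments.

Lemma nonneg_quicksort_law n : nonneg_weights (quicksort_law n).
Proof.
elim/ltn_ind: n => -[|n] IH; first by rewrite /= /nonneg_weights /= ler01.
by rewrite quicksort_lawS; apply: nonneg_weights_mixture => // m mn; exact: IH.
Qed.

Lemma nonneg_insertion_law n : nonneg_weights (insertion_law n).
Proof.
elim/ltn_ind: n => -[|n] IH; first by rewrite /= /nonneg_weights /= ler01.
rewrite insertion_lawS; apply: nonneg_weights_mixture => m *.
- by rewrite divr_ge0// mulr_ge0.
- exact: IH.
- exact: nonneg_quicksort_law.
Qed.

Lemma rmean_quicksort_law1 n : rmean (quicksort_law n) (fun=> 1) = 1.
Proof.
elim/ltn_ind: n => -[|n] IH; first exact: wmean_quicksort_law0.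
rewrite /rmean wmean_quicksort_lawS (eq_bigr (fun=> 1)) => [|j _].
  by rewrite sumr_const card_ord [_ *: _]mulVf// pnatr_eq0.
rewrite /split_mean -[RHS](IH j)//; apply: eq_wmean => x; apply: IH.
by rewrite ltnS leq_subr.
Qed.

(** By [j ^ 2 + (n - j) ^ 2 + n <= (n + 1) ^ 2]. The finite support turns Fourier inversion and the
    identification of the law into finite sums. *)
Lemma quicksort_law_support n : all (fun p => (p.2 <= n ^ 2)%N) (quicksort_law n).
Proof.
elim/ltn_ind: n => -[|n] IH //; rewrite quicksort_lawS /mixture.
have : {in iota 0 n.+1, forall j, (j <= n)%N} by move=> j; rewrite mem_iota.
elim: (iota 0 n.+1) => //= j r IHr rn; rewrite all_cat.
rewrite IHr ?andbT => [|i ir]; last by apply: rn; rewrite inE ir orbT.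
have jn : (j <= n)%N by apply: rn; rewrite inE eqxx.
have := IH j jn; have := IH (n - j)%N; rewrite ltnS leq_subr => /(_ erefl).
elim: (quicksort_law j) => //= p s IHs nuP /andP[pP sP].
rewrite all_cat IHs// andbT all_map; elim: (quicksort_law (n - j)) nuP => //= q t IHt /andP[qP tP].
by rewrite IHt// andbT; clear -pP qP jn; nia.
Qed.
End QuicksortLaw.
(** * Complex exponentials *)

Section Expi.
Variable R : realType.
(* [R[i]] has no [R]-module structure and a [R[i]]-valued norm; its copy [Rcomplex R] is an
   [R]-module with an [R]-valued norm. *)
Local Notation K := (Rcomplex R).
Local Notation cnorm z := (`|z : Rcomplex R|).

Definition expi (t : R) : K := Complex (cos t) (sin t).

Lemma cnormM (z w : K) : cnorm (z * w) = cnorm z * cnorm w.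
Proof. exact: ComplexField.Normc.normcM. Qed.

Lemma cnormE (z : K) : `|z| = Num.sqrt (complex.Re z ^+ 2 + complex.Im z ^+ 2).
Proof. by case: z. Qed.

Lemma cnorm_ReIm (z : K) : `|z| <= `|complex.Re z| + `|complex.Im z|.
Proof.
rewrite cnormE -(@ler_pXn2r _ 2) ?nnegrE ?addr_ge0 ?sqrtr_ge0//.
rewrite sqr_sqrtr ?addr_ge0 ?sqr_ge0// sqrrD !real_normK ?num_real//.
by rewrite [leRHS]addrAC lerDl mulrn_wge0 ?mulr_ge0.
Qed.

Lemma cnorm_Re (z : K) : `|complex.Re z| <= `|z|.
Proof. by rewrite cnormE -sqrtr_sqr ler_wsqrtr// lerDl sqr_ge0. Qed.

Lemma cnormZ (a : R) (z : K) : `|a *: z| = `|a| * `|z|.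
Proof.
by rewrite !cnormE; case: z => x y /=; rewrite !exprMn -mulrDr sqrtrM ?sqr_ge0// sqrtr_sqr.
Qed.

Lemma cscalerAr (a : R) (z w : K) : a *: (z * w : K) = z * (a *: w) :> K.
Proof. by rewrite mulrC scalerAl mulrC. Qed.

Lemma expiD a b : expi (a + b) = expi a * expi b.
Proof. by rewrite /expi cosD sinD; congr Complex; rewrite addrC mulrC [X in _ + X]mulrC. Qed.

Lemma expi0 : expi 0 = 1.
Proof. by rewrite /expi cos0 sin0. Qed.

Lemma norm_expi t : `|expi t| = 1.
Proof. by rewrite cnormE cos2Dsin2 sqrtr1. Qed.

Lemma MVT_bound (f df : R -> R) (t M : R) :
    (forall x : R, is_derive x 1 f (df x)) ->
    (forall c, `|c| <= `|t| -> `|df c| <= M) ->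
  `|f t - f 0| <= M * `|t|.
Proof.
move=> fd dfM; have fc (x y : R) : {within `[x, y], continuous f}.
  apply: continuous_subspaceT => z; have [? _] := fd z.
  exact/differentiable_continuous/derivable1_diffP.
have [t0|t0] := leP 0 t.
  have [c /[!in_itv]/= /andP[c0 ct] ->] := MVT_segment t0 (fun x _ => fd x) (fc 0 t).
  rewrite subr0 normrM ler_wpM2r//; apply: dfM; rewrite !ger0_norm//.
have [c /[!in_itv]/= /andP[c0 ct] h] := MVT_segment (ltW t0) (fun x _ => fd x) (fc t 0).
rewrite distrC h sub0r normrM normrN ler_wpM2r//; apply: dfM.
by rewrite !ler0_norm ?lerN2 // ltW.
Qed.

Lemma norm_sin_le (t : R) : `|sin t| <= `|t|.
Proof.
have := @MVT_bound sin cos t 1 (fun x => is_derive_sin x) (fun c _ => cos_max c).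
by rewrite sin0 subr0 mul1r.
Qed.

Lemma norm_cosB1_le (t : R) : `|cos t - 1| <= `|t|.
Proof.
have := @MVT_bound cos (fun x => - sin x) t 1 (fun x => is_derive_cos x).
rewrite cos0 mul1r; apply=> c _; rewrite normrN; exact: sin_max.
Qed.

Lemma norm_cosB1_le_sqr (t : R) : `|cos t - 1| <= t ^+ 2.
Proof.
have := @MVT_bound cos (fun x => - sin x) t `|t| (fun x => is_derive_cos x).
rewrite cos0 -expr2 real_normK ?num_real//; apply=> c ct.
by rewrite normrN (le_trans (norm_sin_le c)).
Qed.

Lemma norm_sinB_le_sqr (t : R) : `|sin t - t| <= t ^+ 2.
Proof.
have h (x : R) : is_derive x 1 (fun x : R => sin x - x) (cos x - 1).
  by apply: is_deriveB.
have := @MVT_bound (fun x => sin x - x) (fun x => cos x - 1) t `|t| h.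
rewrite sin0 !subr0 -expr2 real_normK ?num_real//; apply=> c ct.
exact: le_trans (norm_cosB1_le c) ct.
Qed.

Lemma norm_expiB1 (t : R) : cnorm (expi t - 1) <= 2 * `|t|.
Proof.
apply: le_trans (cnorm_ReIm _) _; rewrite /= oppr0 addr0.
have := norm_cosB1_le t; have := norm_sin_le t; lra.
Qed.

Lemma norm_expiB (s t : R) : cnorm (expi s - expi t) <= 2 * `|s - t|.
Proof.
have -> : expi s - expi t = expi t * (expi (s - t) - 1).
  by rewrite mulrBr mulr1 -expiD [t + _]addrC subrK.
by rewrite cnormM norm_expi mul1r norm_expiB1.
Qed.

Lemma norm_expi_taylor (t : R) :
  `|expi t - 1 - t *: (Complex 0 1 : K)| <= 2 * t ^+ 2.
Proof.
apply: le_trans (cnorm_ReIm _) _; rewrite /= mulr0 mulr1 oppr0 !addr0.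
have := norm_cosB1_le_sqr t; have := norm_sinB_le_sqr t; lra.
Qed.

Lemma norm_wmean_le (T : Type) (mu : seq (R * T)) (F : T -> K) (g : T -> R) :
    nonneg_weights mu -> (forall x, `|F x| <= g x) ->
  `|wmean mu F| <= rmean mu g.
Proof.
move=> + Fg; rewrite rmeanE /wmean; elim: mu => [|p s IH] /=.
  by rewrite !big_nil normr0.
case/andP=> p0 s0; rewrite !big_cons (le_trans (ler_normD _ _))// lerD ?IH//.
by rewrite cnormZ ger0_norm// ler_wpM2l.
Qed.

Lemma wmean_mull (T : Type) (mu : seq (R * T)) (c : K) (F : T -> K) :
  wmean mu (fun x => c * F x) = c * wmean mu F.
Proof.
rewrite /wmean mulr_sumr; apply: eq_bigr => p _.
by rewrite cscalerAr.
Qed.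

End Expi.
(** * The insertion martingale *)

Section Martingale.
Variable R : realType.
Local Notation K := (Rcomplex R).
Local Notation cnorm z := (`|z : Rcomplex R|).
Local Notation law := (quicksort_law R).
Local Notation ins := (insertion_law R).

Lemma rmean_insertion_cost n (f : nat -> R) :
  rmean (ins n) (fun xd => f xd.1) = rmean (law n) f.
Proof. exact: (wmean_insertion_cost n (f : nat -> R^o)). Qed.

Lemma rmean_insertion_succ n (f : nat -> R) :
  rmean (ins n) (fun xd => f (xd.1 + xd.2)%N) = rmean (law n.+1) f.
Proof. exact: (wmean_insertion_succ n (f : nat -> R^o)). Qed.

Definition mean_depth n (x : nat) : R := (x + n.*2)%N%:R / n.+1%:R.

Lemma rmean_insertion_depth n (f : nat -> R) :
  rmean (ins n) (fun xd => xd.2%:R * f xd.1) =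
  rmean (law n) (fun x => mean_depth n x * f x).
Proof. exact: (wmean_insertion_depth n (f : nat -> R^o)). Qed.

Definition qmean n : R := rmean (law n) (fun x => x%:R).

Lemma qmeanS n : qmean n.+1 = qmean n + (qmean n + n.*2%:R) / n.+1%:R.
Proof.
rewrite /qmean -rmean_insertion_succ.
rewrite (@eq_rmean _ _ _ _ (fun xd => xd.1%:R + xd.2%:R * 1)); last first.
  by move=> xd; rewrite mulr1 natrD.
rewrite rmeanD rmean_insertion_cost (rmean_insertion_depth n (fun=> 1)); congr (_ + _).
rewrite (@eq_rmean _ _ _ _ (fun x => n.+1%:R^-1 * (x%:R + n.*2%:R))); last first.
  by move=> x; rewrite mulr1 /mean_depth natrD mulrC.
by rewrite rmeanZ rmeanD (rmean_cst _ n.*2%:R) rmean_quicksort_law1 mul1r mulrC.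
Qed.

(** A base [z] in place of [5 / 4] would give growth of order [n ^ (2 z - 2)]. The choice [5 / 4]
    gives the square root of [n], so that second moments of depths divided by [n ^ 2] are
    summable. *)
Definition depth_mgf n : R := rmean (ins n) (fun xd => (5 / 4) ^+ xd.2).

Lemma depth_mgf_sum n :
  n.+1%:R * n.+2%:R * depth_mgf n.+1 =
  5 / 2 * \sum_(j < n.+1) j.+1%:R * depth_mgf j.
Proof.
rewrite /depth_mgf insertion_lawS rmean_mixture !mulr_sumr.
apply: eq_bigr => j _ /=.
rewrite (@eq_rmean _ _ _ _ (fun xd => 5 / 4 * (5 / 4) ^+ xd.2)) => [|xd].
  rewrite rmeanZ; set g := rmean _ _.
  by field; rewrite nat1r -natrD !pnatr_eq0.
by rewrite rmean_cst rmean_quicksort_law1 mul1r exprS.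
Qed.

(** Subtracting two consecutive instances of [depth_mgf_sum] leaves only the last term of the
    sum. *)
Lemma depth_mgfS n : n.+2%:R * depth_mgf n.+1 = (n%:R + 5 / 2) * depth_mgf n.
Proof.
have n0 k : k.+1%:R != 0 :> R by rewrite pnatr_eq0.
case: n => [|n].
  by have := depth_mgf_sum 0; rewrite big_ord1 /= !mul1r add0r.
have := depth_mgf_sum n.+1; rewrite big_ord_recr /= [X in _ = X -> _]mulrDr.
rewrite -depth_mgf_sum => h.
apply: (mulfI (n0 n.+1)); rewrite mulrA h -!natr1; ring.
Qed.

(** Induction on the squares, by [(N + 5/2)^2 (N + 1) <= (N + 2)^3]. *)
Lemma depth_mgf_le n : depth_mgf n <= Num.sqrt n.+1%:R.
Proof.
have g0 k : 0 <= depth_mgf k.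
  by apply: rmean_ge0 => [|x]; [exact: nonneg_insertion_law | rewrite exprn_ge0// divr_ge0].
suff h : depth_mgf n ^+ 2 <= n.+1%:R.
  by rewrite -[leLHS]ger0_norm// -sqrtr_sqr ler_wsqrtr.
elim: n => [|n IH].
  by rewrite /depth_mgf /rmean wmean_insertion_law0 expr0 expr1n.
have := depth_mgfS n; move: (g0 n) (g0 n.+1) IH.
rewrite -(natr1 n.+1) -(natr1 n); set N := n%:R : R.
have N0 : 0 <= N by [].
set g := depth_mgf n; set g' := depth_mgf n.+1 => hg hg' IH h.
have N2 : 0 < (N + 1 + 1) ^+ 2 by rewrite exprn_gt0//; lra.
rewrite -(ler_pM2l N2) -exprMn h exprMn.
apply: le_trans (ler_wpM2l (sqr_ge0 _) IH) _; nra.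
Qed.

(** Bernoulli gives [d / 9 <= (10/9)^d], and [(10/9)^2 <= 5/4]; hence [d ^ 2 <= 81 (5/4)^d]. *)
Lemma rmean_depth_sqr n :
  rmean (ins n) (fun xd => xd.2%:R ^+ 2) <= 81 * Num.sqrt n.+1%:R.
Proof.
apply: le_trans (_ : 81 * depth_mgf n <= _); last by rewrite ler_wpM2l// depth_mgf_le.
rewrite /depth_mgf -rmeanZ; apply: ler_rmean; first exact: nonneg_insertion_law.
move=> [_ d] /=.
have bern : 1 + d%:R / 9 <= (10 / 9) ^+ d :> R.
  elim: d => [|d IH]; first by rewrite mul0r addr0.
  rewrite exprS -natr1; have : 0 <= d%:R :> R by []. nra.
have d0 : 0 <= d%:R :> R by [].
have -> : d%:R ^+ 2 = 81 * (d%:R / 9) ^+ 2 :> R by field.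
rewrite ler_wpM2l//; apply: le_trans (_ : ((10 / 9) ^+ d) ^+ 2 <= _).
  by rewrite lerXn2r ?nnegrE ?divr_ge0 ?exprn_ge0 ?divr_ge0//; lra.
by rewrite -exprM mulnC exprM lerXn2r ?nnegrE//; lra.
Qed.

Definition depth_dev n (xd : nat * nat) : R := xd.2%:R - mean_depth n xd.1.

(** The martingale property as orthogonality: given the cost, the depth has mean [mean_depth]. *)
Lemma wmean_depth_dev (n : nat) (F : nat -> K) :
  wmean (ins n) (fun xd => depth_dev n xd *: F xd.1) = 0.
Proof.
rewrite (eq_wmean _ (G := fun xd => xd.2%:R *: F xd.1 - mean_depth n xd.1 *: F xd.1)).
  by rewrite wmeanB wmean_insertion_depth
    (wmean_insertion_cost n (fun x => mean_depth n x *: F x)) subrr.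
by move=> xd; rewrite scalerBl.
Qed.

Lemma rmean_depth_dev (n : nat) (f : nat -> R) :
  rmean (ins n) (fun xd => depth_dev n xd * f xd.1) = 0.
Proof.
rewrite (eq_rmean _ (g := fun xd => xd.2%:R * f xd.1 - mean_depth n xd.1 * f xd.1)).
  by rewrite rmeanB rmean_insertion_depth
    (rmean_insertion_cost n (fun x => mean_depth n x * f x)) subrr.
by move=> xd; rewrite mulrBl.
Qed.

Lemma rmean_depth_dev_sqr n :
  rmean (ins n) (fun xd => depth_dev n xd ^+ 2) <= 81 * Num.sqrt n.+1%:R.
Proof.
apply: le_trans (rmean_depth_sqr n).
rewrite (eq_rmean _ (g := fun xd => xd.2%:R ^+ 2 -
  (2 * (depth_dev n xd * mean_depth n xd.1) + mean_depth n xd.1 ^+ 2))); last first.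
  by move=> xd; rewrite /depth_dev; ring.
rewrite rmeanB rmeanD rmeanZ rmean_depth_dev mulr0 add0r gerBl.
by apply: rmean_ge0 => [|x]; [exact: nonneg_insertion_law | exact: sqr_ge0].
Qed.

Definition invsqrt n : R := (Num.sqrt n.+1%:R)^-1.

Lemma invsqrt_gt0 n : 0 < invsqrt n.
Proof. by rewrite invr_gt0 sqrtr_gt0 ltr0n. Qed.

(** The order [n ^ (-3/2)] is expressed as a difference of values of [invsqrt], so that sums over
    [n] telescope. *)
Lemma rmean_step_sqr n :
  rmean (ins n) (fun xd => depth_dev n xd ^+ 2) / n.+2%:R ^+ 2 <=
  162 * (invsqrt n - invsqrt n.+1).
Proof.
rewrite ler_pdivrMr ?exprn_gt0 ?ltr0n//; apply: le_trans (rmean_depth_dev_sqr n) _.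
rewrite /invsqrt; set r := Num.sqrt n.+1%:R; set r' := Num.sqrt n.+2%:R.
have r0 : 0 < r by rewrite sqrtr_gt0 ltr0n.
have r2 : r ^+ 2 = n.+1%:R by rewrite sqr_sqrtr.
have r0' : 0 < r' by rewrite sqrtr_gt0 ltr0n.
have r2' : r' ^+ 2 = n.+2%:R by rewrite sqr_sqrtr.
have e : r' ^+ 2 = r ^+ 2 + 1 by rewrite r2 r2' -natr1.
have rr : r <= r' by rewrite ler_wsqrtr// ler_nat.
rewrite -r2'.
have -> : 162 * (r^-1 - r'^-1) * (r' ^+ 2) ^+ 2 =
   162 * (r' ^+ 2 - r ^+ 2) * r' ^+ 3 / (r * (r' + r)).
  by field; rewrite ?lt0r_neq0 ?addr_gt0.
rewrite ler_pdivlMr ?mulr_gt0 ?addr_gt0// e.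
have [r1 r1'] := (ltW r0, ltW r0').
have h1 : r * r <= r' * r' by exact: ler_pM.
have h2 : r * r * (r' + r) <= r' * r' * (r' + r').
  by apply: ler_pM => //; [exact: mulr_ge0 | exact: addr_ge0 | exact: lerD].
have -> : 162 * (r ^+ 2 + 1 - r ^+ 2) * r' ^+ 3 = 81 * (r' * r' * (r' + r')) by ring.
by rewrite -[X in X <= _]mulrA ler_wpM2l// mulrA.
Qed.

Definition centered_chf n (t : R) : K :=
  wmean (law n) (fun x => expi (t * (x%:R - qmean n))).

(* The martingale property: rescaled by their number of keys plus one, the centered costs
   before and after an insertion differ by a multiple of the centered depth. *)
Lemma centered_step n (s : R) (xd : nat * nat) :
  s / n.+2%:R * ((xd.1 + xd.2)%N%:R - qmean n.+1) =
  s / n.+1%:R * (xd.1%:R - qmean n) + s / n.+2%:R * depth_dev n xd.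
Proof.
rewrite qmeanS /depth_dev /mean_depth !natrD -!natr1.
set N := n%:R : R; have N0 : 0 <= N by [].
by rewrite -addnn natrD -/N; field; rewrite !lt0r_neq0//; lra.
Qed.

(** The exponential of the increment is expanded to second order. The first-order term is the depth
    deviation times a function of the cost, so its mean vanishes and only the second moment of the
    increment remains. *)
Lemma centered_chf_step n t :
  cnorm (centered_chf n.+1 (t / n.+2%:R) - centered_chf n (t / n.+1%:R)) <=
  324 * t ^+ 2 * (invsqrt n - invsqrt n.+1).
Proof.
rewrite /centered_chf -(wmean_insertion_succ n
  (fun x => expi (t / n.+2%:R * (x%:R - qmean n.+1)))) -wmean_insertion_cost.
pose u (xd : nat * nat) := t / n.+1%:R * (xd.1%:R - qmean n) : R.
pose v (xd : nat * nat) := t / n.+2%:R * depth_dev n xd : R.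
pose w x := (t / n.+2%:R) *: (expi (t / n.+1%:R * (x%:R - qmean n)) * Complex 0 1) : K.
rewrite -wmeanB -[X in cnorm X]subr0 -(wmean_depth_dev n w) -wmeanB.
apply: le_trans (norm_wmean_le (g := fun xd => 2 * (t / n.+2%:R) ^+ 2 * depth_dev n xd ^+ 2)
  (nonneg_insertion_law R n) _) _; last first.
  rewrite rmeanZ; have := rmean_step_sqr n.
  set V := rmean _ _ => h.
  have -> : 2 * (t / n.+2%:R) ^+ 2 * V = (2 * t ^+ 2) * (V / n.+2%:R ^+ 2).
    by rewrite exprMn exprVn; ring.
  apply: le_trans (ler_wpM2l _ h) _; first by rewrite mulr_ge0 ?sqr_ge0.
  by rewrite le_eqVlt; apply/orP; left; apply/eqP; ring.
move=> xd; rewrite centered_step expiD -/(u xd) -/(v xd).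
have -> : expi (u xd) * expi (v xd) - expi (u xd) - depth_dev n xd *: w xd.1 =
    expi (u xd) * (expi (v xd) - 1 - v xd *: (Complex 0 1 : K)) :> K.
  rewrite /w scalerA [depth_dev _ _ * _]mulrC -/(v xd) -/(u xd) cscalerAr.
  by rewrite !mulrBr mulr1.
rewrite cnormM norm_expi mul1r (le_trans (norm_expi_taylor _))//.
by rewrite /v exprMn mulrA.
Qed.

Lemma centered_chf_Cauchy n m t : (n <= m)%N ->
  cnorm (centered_chf m (t / m.+1%:R) - centered_chf n (t / n.+1%:R)) <=
  324 * t ^+ 2 * invsqrt n.
Proof.
move=> nm; apply: (@le_trans _ _ (324 * t ^+ 2 * (invsqrt n - invsqrt m))).
  elim: m nm => [|m IH]; first by rewrite leqn0 => /eqP ->; rewrite !subrr normr0 mulr0.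
  rewrite leq_eqVlt => /predU1P[->|]; first by rewrite !subrr normr0 mulr0.
  rewrite ltnS => nm; have {}IH := IH nm; have h := centered_chf_step m t.
  set a := centered_chf m.+1 _ in h *; set b := centered_chf m _ in h IH.
  set c := centered_chf n _ in IH *.
  have -> : a - c = (a - b) + (b - c) :> K by rewrite addrA subrK.
  by apply: le_trans (ler_normD _ _) _; lra.
apply: ler_wpM2l; first by apply: mulr_ge0; [exact: ler0n | exact: sqr_ge0].
by rewrite gerBl; exact/ltW/invsqrt_gt0.
Qed.

(** Each increment is orthogonal to the functions of the current cost, so the second moments of the
    increments add up, and their bounds telescope. *)
Lemma rmean_variance n :
  rmean (law n) (fun x => (x%:R - qmean n) ^+ 2) <= 162 * n.+1%:R ^+ 2.
Proof.
pose W k := rmean (law k) (fun x => (x%:R - qmean k) ^+ 2) / k.+1%:R ^+ 2.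
suff h : W n <= 162 * (1 - invsqrt n).
  rewrite -ler_pdivrMr ?exprn_gt0 ?ltr0n//; apply: le_trans h _.
  have := invsqrt_gt0 n; lra.
elim: n => [|n IH].
  rewrite /W /qmean /rmean !wmean_quicksort_law0 /invsqrt sqrtr1 invr1 !subrr mulr0.
  by rewrite expr0n mul0r.
apply: le_trans (_ : W n + 162 * (invsqrt n - invsqrt n.+1) <= _); last by lra.
rewrite /W -rmean_insertion_succ -rmean_insertion_cost.
pose u (xd : nat * nat) := (xd.1%:R - qmean n) : R.
(* Coefficient of the cross term of the square; it depends on the cost alone. *)
pose c (x : nat) := 2 / (n.+2%:R * n.+1%:R) * (x%:R - qmean n) : R.
rewrite mulrC -rmeanZ (eq_rmean _ (g := fun xd => n.+1%:R ^- 2 * u xd ^+ 2 +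
   (depth_dev n xd * c xd.1
    + n.+2%:R ^- 2 * depth_dev n xd ^+ 2))); last first.
  move=> xd; have := centered_step n 1 xd; rewrite !mul1r -/(u xd).
  rewrite -!exprVn -!exprMn => ->; rewrite /c -/(u xd).
  by field; rewrite ?nat1r -?natrD !pnatr_eq0.
rewrite rmeanD rmeanZ rmeanD (rmean_depth_dev n c) add0r rmeanZ.
by rewrite mulrC lerD2l mulrC; exact: rmean_step_sqr.
Qed.

(** From the variance, by [|a| <= a ^ 2 / (2 N) + N / 2] with [N = n + 1]. *)
Lemma rmean_abs_dev n : rmean (law n) (fun x => `|x%:R - qmean n|) <= 82 * n.+1%:R.
Proof.
have N0 : 0 < n.+1%:R :> R by rewrite ltr0n.
apply: le_trans (_ : rmean (law n) (fun x => (2 * n.+1%:R)^-1 * ((x%:R - qmean n) ^+ 2)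
   + n.+1%:R / 2) <= _).
  apply: ler_rmean; first exact: nonneg_quicksort_law.
  move=> x; rewrite -[(_ - _) ^+ 2]real_normK ?num_real//; set a := `|_|.
  rewrite -subr_ge0.
  have -> : (2 * n.+1%:R)^-1 * a ^+ 2 + n.+1%:R / 2 - a = (a - n.+1%:R) ^+ 2 / (2 * n.+1%:R).
    by field; rewrite nat1r pnatr_eq0.
  by rewrite divr_ge0 ?sqr_ge0 ?mulr_ge0.
rewrite rmeanD rmeanZ rmean_cst rmean_quicksort_law1 mul1r.
have := rmean_variance n; rewrite -(ler_pM2l (_ : 0 < (2 * n.+1%:R)^-1)); last first.
  by rewrite invr_gt0 mulr_gt0.
have -> : (2 * n.+1%:R)^-1 * (162 * n.+1%:R ^+ 2) = 81 * n.+1%:R :> R.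
  by field; rewrite nat1r pnatr_eq0.
set V := _ * rmean _ _; move: N0; set N := n.+1%:R : R; lra.
Qed.

(** The martingale is normalized by the size plus one, the limit law by the size. A first absolute
    moment of order [n] makes the change of normalization cost [O(|t| / n)]. *)
Lemma centered_chf_rescale n t :
  cnorm (centered_chf n.+1 (t / n.+1%:R) - centered_chf n.+1 (t / n.+2%:R)) <=
  164 * `|t| / n.+1%:R.
Proof.
have N0 k : 0 < k.+1%:R :> R by rewrite ltr0n.
rewrite /centered_chf -wmeanB.
apply: le_trans (norm_wmean_le (g := fun x => 2 * `|t| / (n.+1%:R * n.+2%:R) *
   `|x%:R - qmean n.+1|) (nonneg_quicksort_law R n.+1) _) _; last first.
  rewrite rmeanZ; apply: le_trans (ler_wpM2l _ (rmean_abs_dev n.+1)) _.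
    by rewrite divr_ge0 ?mulr_ge0.
  rewrite le_eqVlt; apply/orP; left; apply/eqP.
  by field; rewrite ?nat1r -?natrD !pnatr_eq0.
move=> x; apply: le_trans (norm_expiB _ _) _.
rewrite -mulrBl normrM mulrA ler_wpM2r//.
have -> : t / n.+1%:R - t / n.+2%:R = t / (n.+1%:R * n.+2%:R).
  by field; rewrite ?nat1r -?natrD !pnatr_eq0.
by rewrite normrM normfV (ger0_norm (mulr_ge0 _ _))// mulrA.
Qed.

Lemma centered_chf_close : exists2 A : R, 0 <= A &
  forall n m t, (0 < n)%N -> (n <= m)%N ->
  cnorm (centered_chf m (t / m%:R) - centered_chf n (t / n%:R)) <=
  A * (1 + t ^+ 2) / Num.sqrt n%:R.
Proof.
(* [652 = 164 + 324 + 164]: one martingale comparison between two changes of normalization. *)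
exists 652; first exact: ler0n.
case=> // n [//|m] t _ nm.
have h1 := centered_chf_rescale m t; have h2 := centered_chf_rescale n t.
have h3 := centered_chf_Cauchy t nm.
set a := centered_chf m.+1 (t / m.+1%:R) in h1 *.
set b := centered_chf m.+1 (t / m.+2%:R) in h1 h3.
set c := centered_chf n.+1 (t / n.+2%:R) in h2 h3.
set d := centered_chf n.+1 (t / n.+1%:R) in h2 *.
have -> : a - d = (a - b) + (b - c) - (d - c) :> K.
  by rewrite addrA subrK opprB addrA subrK.
apply: le_trans (ler_normB _ _) _.
apply: le_trans (lerD (ler_normD _ _) (lexx _)) _.
rewrite -/(invsqrt n).
have i0 := invsqrt_gt0 n.
have mono k l : (k <= l)%N -> invsqrt l <= invsqrt k.
  by move=> kl; rewrite lef_pV2 ?posrE ?sqrtr_gt0 ?ltr0n// ler_wsqrtr// ler_nat.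
have inv k : (k.+1%:R)^-1 <= invsqrt k.
  rewrite lef_pV2 ?posrE ?sqrtr_gt0 ?ltr0n// -[leRHS]sqr_sqrtr// expr2.
  by rewrite ler_peMl ?sqrtr_ge0// -[leLHS]sqrtr1 ler_wsqrtr// ler1n.
have im : m.+1%:R^-1 <= invsqrt n by apply: le_trans (inv m) (mono _ _ _).
have in' := inv n; have iS := mono n n.+1 (leqnSn n).
have tt : `|t| <= 1 + t ^+ 2.
  by rewrite -[t ^+ 2]real_normK ?num_real//; have := normr_ge0 t; nra.
have t0 := normr_ge0 t; have s0 := sqr_ge0 t.
have p1 : `|t| * m.+1%:R^-1 <= (1 + t ^+ 2) * invsqrt n.
  by apply: ler_pM => //; rewrite invr_ge0.
have p2 : `|t| * n.+1%:R^-1 <= (1 + t ^+ 2) * invsqrt n.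
  by apply: ler_pM => //; rewrite invr_ge0.
have p3 : t ^+ 2 * invsqrt n.+1 <= (1 + t ^+ 2) * invsqrt n.
  by apply: ler_pM => //; [exact/ltW/invsqrt_gt0 | rewrite lerDr].
move: h1 h2 h3 p1 p2 p3.
set x1 := `|_ - _|; set x2 := `|_ - _|; set x3 := `|_ - _|; clear.
rewrite -!(mulrA 164) -(mulrA 324) -(mulrA 652).
set y1 := `|t| / _; set y2 := `|t| / _; set y3 := t ^+ 2 * _; set y := _ * invsqrt n.
lra.
Qed.

End Martingale.
(** * Decay of the characteristic functions *)

Section CharacteristicDecay.
Variable R : realType.
Local Notation K := (Rcomplex R).
Local Notation cnorm z := (`|z : Rcomplex R|).
Local Notation law := (quicksort_law R).

Definition chf (mu : seq (R * nat)) (t : R) : K := wmean mu (fun x => expi (t * x%:R)).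

Lemma Re_wmean (T : Type) (mu : seq (R * T)) (F : T -> K) :
  complex.Re (wmean mu F) = rmean mu (fun x => complex.Re (F x)).
Proof.
rewrite rmeanE /wmean; elim: mu => [|p s IH]; first by rewrite !big_nil.
by rewrite !big_cons -IH; case: (F p.2) => a b; case: (\sum_(_ <- _) _).
Qed.

Lemma Im_wmean (T : Type) (mu : seq (R * T)) (F : T -> K) :
  complex.Im (wmean mu F) = rmean mu (fun x => complex.Im (F x)).
Proof.
rewrite rmeanE /wmean; elim: mu => [|p s IH]; first by rewrite !big_nil.
by rewrite !big_cons -IH; case: (F p.2) => a b; case: (\sum_(_ <- _) _).
Qed.

Lemma norm_chfN mu t : `|chf mu (- t)| = `|chf mu t|.
Proof.
rewrite !cnormE !Re_wmean !Im_wmean /=.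
have -> : rmean mu (fun x => cos (- t * x%:R)) = rmean mu (fun x => cos (t * x%:R)).
  by apply: eq_rmean => x; rewrite mulNr cosN.
have -> : rmean mu (fun x => sin (- t * x%:R)) = rmean mu (fun x => -1 * sin (t * x%:R)).
  by apply: eq_rmean => x; rewrite mulN1r mulNr sinN.
by rewrite rmeanZ mulN1r sqrrN.
Qed.

Lemma norm_chf_le1 mu t : nonneg_weights mu -> rmean mu (fun=> 1) = 1 -> `|chf mu t| <= 1.
Proof.
by move=> mu0 mu1; rewrite -[leRHS]mu1; apply: norm_wmean_le => // x; rewrite norm_expi.
Qed.

(** Symmetrization: the squared modulus is the characteristic function of the difference of two
    independent copies. *)
Lemma norm_chf_sqr mu t :
  `|chf mu t| ^+ 2 = rmean mu (fun x => rmean mu (fun y => cos (t * (x%:R - y%:R)))).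
Proof.
rewrite cnormE sqr_sqrtr ?addr_ge0 ?sqr_ge0// Re_wmean Im_wmean /= !expr2.
rewrite -!rmeanZ -rmeanD; apply: eq_rmean => x.
rewrite [RHS](eq_rmean mu (g := fun y => cos (t * x%:R) * cos (t * y%:R) +
  sin (t * x%:R) * sin (t * y%:R))) => [|y]; last by rewrite mulrBr cosB.
by rewrite rmeanD !rmeanZ [X in _ = X + _]mulrC [X in _ = _ + X]mulrC.
Qed.

(** Two independent copies fall in [A] and [B] with the product of the probabilities, and there the
    cosine loses [g]. Taking the square root halves the gain. *)
Lemma norm_chf_separated mu t (A B : pred nat) (g : R) : nonneg_weights mu ->
    rmean mu (fun=> 1) = 1 -> 0 <= g ->
    (forall x y, A x -> B y -> cos (t * (x%:R - y%:R)) <= 1 - g) ->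
  `|chf mu t| <= 1 - g * rmean mu (fun x => (A x)%:R) * rmean mu (fun y => (B y)%:R) / 2.
Proof.
move=> mu0 mu1 g0 AB; set pA := rmean mu _; set pB := rmean mu _.
have p01 (S : pred nat) : 0 <= rmean mu (fun x => (S x)%:R) <= 1.
  by rewrite rmean_ge0//= -[leRHS]mu1; apply: ler_rmean => // x; case: (S x).
have /andP[pA0 pA1] : 0 <= pA <= 1 := p01 A.
have /andP[pB0 pB1] : 0 <= pB <= 1 := p01 B.
have h : `|chf mu t| ^+ 2 <= 1 - g * pA * pB.
  rewrite norm_chf_sqr.
  have -> : 1 - g * pA * pB =
      rmean mu (fun x => rmean mu (fun y => 1 - g * (A x)%:R * (B y)%:R)).
    rewrite (eq_rmean mu (g := fun x => 1 - g * pB * (A x)%:R)).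
      by rewrite rmeanB rmeanZ mu1 -/pA mulrAC.
    by move=> x; rewrite rmeanB mu1 rmeanZ -/pB mulrAC.
  apply: ler_rmean => // x; apply: ler_rmean => // y.
  have [Ax|_] := boolP (A x); have [By|_] := boolP (B y);
    rewrite ?mulr1 ?mulr0 ?subr0 ?mul0r ?subr0 ?cos_le1//.
  exact: AB.
have z0 := normr_ge0 (chf mu t).
have [z1 gp0] : `|chf mu t| <= 1 /\ 0 <= g * pA * pB.
  by split; [exact: norm_chf_le1 | rewrite !mulr_ge0].
move: h z0 z1 gp0; set s := g * pA * pB; set z := `|_|; clear => h z0 z1 s0.
have [|sz] := leP z (1 - s / 2); first by [].
have : s <= 1 by have := sqr_ge0 z; lra.
move=> s1; nra.
Qed.

Lemma chf_quicksortS n t : chf (law n.+1) t =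
  n.+1%:R^-1 *: \sum_(j < n.+1) (expi (t * n%:R) * (chf (law j) t * chf (law (n - j)) t)) :> K.
Proof.
rewrite /chf wmean_quicksort_lawS; congr (_ *: _); apply: eq_bigr => j _.
transitivity (wmean (law j) (fun x : nat =>
    (expi (t * n%:R) * chf (law (n - j)) t : K) * expi (t * x%:R) : K)).
  apply: eq_wmean => x; rewrite /chf mulrAC -wmean_mull; apply: eq_wmean => y.
  by rewrite -!expiD; congr expi; rewrite !natrD; ring.
by rewrite wmean_mull -/(chf _ _) mulrAC mulrA.
Qed.

Lemma norm_chf_quicksort_subsolution t :
  halving_subsolution (fun n => `|chf (law n) t|).
Proof.
move=> n; rewrite chf_quicksortS cnormZ mulrA normfV ger0_norm// mulfV ?pnatr_eq0// mul1r.
apply: le_trans (ler_norm_sum _ _ _) _; apply: ler_sum => j _.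
by rewrite !cnormM norm_expi mul1r.
Qed.

Lemma norm_chf_quicksort_le1 n t : 0 <= `|chf (law n) t| <= 1.
Proof.
by rewrite normr_ge0/= norm_chf_le1 ?rmean_quicksort_law1//; exact: nonneg_quicksort_law.
Qed.

(** [Q_3] is 2 with probability 1/3 and 3 with probability 2/3; the gain is [1 - cos t] times half
    the product of these. *)
Lemma norm_chf_quicksort3 t : `|chf (law 3) t| <= 1 - (1 - cos t) / 9.
Proof.
have law0 (f : nat -> R) : rmean (law 0) f = f 0%N.
  exact: (wmean_quicksort_law0 (f : nat -> R^o)).
have law1 (f : nat -> R) : rmean (law 1) f = f 0%N.
  by rewrite quicksort_lawS rmean_mixture big_ord1 /= !law0 invr1 mul1r.
have law2 (f : nat -> R) : rmean (law 2) f = f 1%N.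
  rewrite quicksort_lawS rmean_mixture !big_ord_recl big_ord0 /= /bump /= subn0.
  rewrite law0 law1 addr0 subnn law1 law0; lra.
have law3 (f : nat -> R) : rmean (law 3) f = (2 * f 3%N + f 2%N) / 3.
  rewrite quicksort_lawS rmean_mixture !big_ord_recl big_ord0 /= /bump /= subn0.
  rewrite law0 law2 !law1 addr0 subnn law2 law0; lra.
have := @norm_chf_separated (law 3) t (pred1 3%N) (pred1 2%N) (1 - cos t)
  (nonneg_quicksort_law _ _) (rmean_quicksort_law1 _ _).
rewrite !law3 /= => h; apply: le_trans (h _ _) _.
- by rewrite subr_ge0 cos_le1.
- by move=> x y /eqP -> /eqP ->; rewrite -natrB// mulr1 opprB addrC subrK.
- by lra.
Qed.

(** Only the last term [a n * a 0] of the sum retains the gain; the others are bounded by 1. *)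
Lemma subsolution_next (a : nat -> R) n (e : R) :
    (forall n, 0 <= a n <= 1) -> halving_subsolution a ->
  a n <= 1 - e -> a n.+1 <= 1 - e / n.+1%:R.
Proof.
move=> a01 arec ae; rewrite -(ler_pM2l (_ : 0 < n.+1%:R)) ?ltr0n//.
apply: le_trans (arec n) _; rewrite big_ord_recr /= subnn.
have h : \sum_(j < n) a j * a (n - j)%N <= n%:R.
  rewrite -[n in leRHS]card_ord -sumr_const; apply: ler_sum => j _.
  have /andP[a0 a1] := a01 j; have /andP[b0 b1] := a01 (n - j)%N.
  exact: le_trans (ler_piMl b0 a1) b1.
have /andP[a0 a1] := a01 n; have /andP[_ b1] := a01 0%N.
rewrite mulrBr mulr1 mulrCA mulfV ?pnatr_eq0// mulr1 -natr1.
have := ler_piMr a0 b1; lra.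
Qed.

(** These sizes form the window of [subsolution_decay] for [M = 3]. The gain is divided by 4 and
    then by 5 when passing to the next sizes: [180 = 9 * 4 * 5]. *)
Lemma norm_chf_quicksort345 t m : (3 <= m < 6)%N ->
  `|chf (law m) t| <= 1 - (1 - cos t) / 180.
Proof.
have e0 : 0 <= 1 - cos t by rewrite subr_ge0 cos_le1.
have next n e := @subsolution_next _ n e (norm_chf_quicksort_le1 ^~ t)
  (norm_chf_quicksort_subsolution t).
have h3 := norm_chf_quicksort3 t; have h4 := next _ _ h3; have h5 := next _ _ h4.
case: m => [//|[//|[//|[|[|[|//]]]]]] _.
- by apply: le_trans h3 _; lra.
- by apply: le_trans h4 _; lra.
- by apply: le_trans h5 _; lra.
Qed.

(** The interval is half-open so that its mass is a difference of two values of a distribution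
    function. *)
Definition charges (a b p : R) (N : nat) := forall n, (N <= n)%N ->
  p <= rmean (law n) (fun x => (a < (x%:R - qmean R n) / n%:R <= b)%R%:R).

Lemma ler_cos_pi (x y : R) : 0 <= x -> x <= y -> y <= pi -> cos y <= cos x.
Proof.
move=> x0 xy ypi; have xin : x \in `[0, pi] by rewrite in_itv/= x0 (le_trans xy).
have yin : y \in `[0, pi] by rewrite in_itv/= ypi (le_trans x0).
by rewrite leNgt ltr_cos// -leNgt.
Qed.

(** For one copy in each interval, the phase lies between [k0 * (a2 - b1)] and
    [k1 * (b2 - a1) <= pi], a range on which the cosine decreases. *)
Lemma norm_chf_quicksort_window (a1 b1 a2 b2 p k0 k1 : R) (N m : nat) (t : R) :
    (0 < N)%N -> 0 <= p -> charges a1 b1 p N -> charges a2 b2 p N ->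
    0 <= k0 -> b1 <= a2 -> a1 <= b2 -> k1 * (b2 - a1) <= pi ->
    (N <= m)%N -> k0 <= m%:R * t <= k1 ->
  `|chf (law m) t| <= 1 - (1 - cos (k0 * (a2 - b1))) * p ^+ 2 / 2.
Proof.
move=> N0 p0 h1 h2 k00 ba ab kpi Nm /andP[k0m mk1].
have m0 : 0 < m%:R :> R by rewrite ltr0n (leq_trans N0).
pose A2 x := a2 < (x%:R - qmean R m) / m%:R <= b2.
pose A1 x := a1 < (x%:R - qmean R m) / m%:R <= b1.
have e0 : 0 <= 1 - cos (k0 * (a2 - b1)) by rewrite subr_ge0 cos_le1.
apply: le_trans (@norm_chf_separated (law m) t A2 A1 _ (nonneg_quicksort_law _ _)
  (rmean_quicksort_law1 _ _) e0 _) _.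
  move=> x y /andP[xa xb] /andP[ya yb]; rewrite subKr.
  pose dxy := (x%:R - qmean R m) / m%:R - (y%:R - qmean R m) / m%:R.
  have -> : t * (x%:R - y%:R) = m%:R * t * dxy.
    by rewrite /dxy; field; rewrite lt0r_neq0.
  have d1 : a2 - b1 <= dxy by rewrite /dxy; lra.
  have d2 : dxy <= b2 - a1 by rewrite /dxy; lra.
  have l1 : k0 * (a2 - b1) <= m%:R * t * dxy by apply: ler_pM => //; lra.
  have l2 : m%:R * t * dxy <= k1 * (b2 - a1) by apply: ler_pM => //; lra.
  have l0 : 0 <= k0 * (a2 - b1) by rewrite mulr_ge0// subr_ge0.
  by apply: ler_cos_pi => //; exact: le_trans kpi.
have := h1 m Nm; have := h2 m Nm; rewrite -/A1 -/A2.
set p1 := rmean _ _; set p2 := rmean _ _ => hp1 hp2.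
have : p ^+ 2 <= p1 * p2 by rewrite expr2 ler_pM.
move=> hp; rewrite lerD2l lerN2 ler_wpM2r ?invr_ge0// -[leRHS]mulrA.
by rewrite ler_wpM2l.
Qed.

Lemma norm_chf_quicksort_decay (a1 b1 a2 b2 p : R) (N : nat) :
    a1 < b2 -> b1 < a2 -> 0 < p -> charges a1 b1 p N -> charges a2 b2 p N ->
  exists C : R, forall t, `|t| <= pi -> forall n,
    `|chf (law n) t| * (1 + (n%:R * t) ^+ 2) ^+ 3 <= C.
Proof.
move=> ab ba p0 h1 h2.
wlog N0 : N h1 h2 / (0 < N)%N.
  by move=> /(_ N.+1); apply => // n Nn; [apply: h1 | apply: h2]; exact: ltnW.
have pi0 := @pi_gt0 R.
have w0 : 0 < b2 - a1 by rewrite subr_gt0.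
have v0 : 0 < a2 - b1 by rewrite subr_gt0.
(* On the window used for small [t], [m * t] ranges over [[k0, 4 k0]]; this [k0] keeps the phases,
   and [k0 * (a2 - b1)], below [pi]. *)
pose k0 := pi / 4 / (b2 - a1 + (a2 - b1)).
have wv0 : 0 < b2 - a1 + (a2 - b1) by exact: addr_gt0.
have k00 : 0 < k0 by rewrite !divr_gt0.
have k0E : 4 * (k0 * (b2 - a1 + (a2 - b1))) = pi.
  by rewrite /k0; field; rewrite lt0r_neq0.
have kw : 0 < k0 * (b2 - a1) by rewrite mulr_gt0.
have kv : 0 < k0 * (a2 - b1) by rewrite mulr_gt0.
(* Up to [t0] the window starts at a size about [k0 / t >= N], where the two intervals are charged;
   above [t0] the sizes 3, 4 and 5 serve. *)
pose t0 := k0 / N%:R.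
have N0' : 1 <= N%:R :> R by rewrite ler1n.
have tN : t0 * N%:R = k0 by rewrite /t0 mulfVK// lt0r_neq0// ltr0n.
have t00 : 0 < t0 by rewrite divr_gt0// ltr0n.
have cos_lt1 (x : R) : 0 < x -> x <= pi -> 0 < 1 - cos x.
  move=> x0 xpi; have xin : x \in `[0, pi] by rewrite in_itv/= xpi ltW.
  have oin : (0 : R) \in `[0, pi] by rewrite in_itv/= lexx pi_ge0.
  by rewrite subr_gt0; have := ltr_cos oin xin; rewrite cos0 x0 => ->.
have d10 : 0 < 1 - cos (k0 * (a2 - b1)) by apply: cos_lt1 => //; lra.
pose d := Num.min (2^-1) (Num.min ((1 - cos (k0 * (a2 - b1))) * p ^+ 2 / 2)
                                  ((1 - cos (Num.min t0 pi)) / 180)).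
have d0 : 0 < d.
  rewrite !lt_min invr_gt0 ltr0n /= !divr_gt0 ?mulr_gt0 ?exprn_gt0//=.
  by apply: cos_lt1; [rewrite lt_min t00 | rewrite ge_min lexx orbT].
have d1 : d < 1 by rewrite gt_min; apply/orP; left; lra.
have [C hC] := @subsolution_decay R d (2 * k0 + 3 * pi) (ltac:(by rewrite d0 d1))
  (ltac:(lra)).
(* The value 1 covers [t = 0], where no window provides a gain. *)
exists (Num.max C 1) => t.
wlog t_ge0 : t / 0 <= t.
  move=> ih tpi n; have [|tn] := leP 0 t; first by move=> ?; exact: ih.
  by rewrite -norm_chfN -[_ * t]opprK -mulrN sqrrN; apply: ih;
    rewrite ?normrN// oppr_ge0 ltW.
rewrite ger0_norm// => tpi n; rewrite le_max.
have [->|tN0] := eqVneq t 0.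
  apply/orP; right; rewrite mulr0 expr0n addr0 expr1n mulr1.
  by have /andP[] := norm_chf_quicksort_le1 n 0.
have {}t_ge0 : 0 < t by rewrite lt0r tN0.
apply/orP; left.
have decay M (M0 : (0 < M)%N) (Mt : M%:R * t <= 2 * k0 + 3 * pi) :=
  hC (fun n => `|chf (law n) t|) M t (ltW t_ge0) M0 Mt (norm_chf_quicksort_le1 ^~ t)
    (norm_chf_quicksort_subsolution t).
have [tt0|tt0] := leP t t0; last first.
  apply: (decay 3%N) => //; first by lra.
  move=> m m36; apply: le_trans (norm_chf_quicksort345 t m36) _.
  rewrite lerD2l lerN2; apply: le_trans (_ : (1 - cos (Num.min t0 pi)) / 180 <= _).
    by rewrite !ge_min lexx !orbT.
  rewrite ler_wpM2r ?invr_ge0// lerD2l lerN2.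
  by apply: ler_cos_pi => //; [rewrite le_min !ltW | rewrite ge_min ltW].
have kt0 : 0 <= k0 / t by rewrite divr_ge0 ?ltW.
(* The first integer above [k0 / t]: thus [k0 < M * t <= k0 + t <= 2 k0], and sizes below [2 M] stay
   within [4 k0]. *)
pose M := (Num.truncn (k0 / t)).+1.
have /andP[Ml Mu] := truncn_itv kt0.
have Mu' : k0 < M%:R * t by rewrite -ltr_pdivrMr.
have Ml' : M%:R * t <= k0 + t.
  by rewrite /M -natr1 mulrDl mul1r lerD2r -ler_pdivlMr.
have tk : t <= k0 by rewrite (le_trans tt0)// -tN ler_peMr// ltW.
have NM : (N <= M)%N.
  rewrite -(ler_nat R); have : N%:R <= k0 / t; last by move=> h; exact: le_trans h (ltW Mu).
  by rewrite ler_pdivlMr// -tN mulrC ler_wpM2r.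
apply: (decay M) => //; first by lra.
move=> m /andP[Mm m2M].
apply: le_trans (norm_chf_quicksort_window (k1 := 4 * k0) N0 (ltW p0) h1 h2 (ltW k00)
  (ltW ba) (ltW ab) _ (leq_trans NM Mm) _) _.
- by lra.
- apply/andP; split.
    by apply: le_trans (ltW Mu') _; apply: ler_wpM2r; [exact: ltW | by rewrite ler_nat].
  apply: (@le_trans _ _ ((2 * M%:R) * t)); last by lra.
  apply: ler_wpM2r; first exact: ltW.
  by have : m%:R <= M.*2%:R :> R by [rewrite ler_nat ltnW]; rewrite -mul2n natrM.
- by rewrite lerD2l lerN2 !ge_min lexx !orbT.
Qed.

End CharacteristicDecay.
(** * Fourier inversion *)

Section FourierInversion.
Variable R : realType.
Local Notation K := (Rcomplex R).
Local Notation cnorm z := (`|z : Rcomplex R|).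
Local Notation law := (quicksort_law R).

Lemma sin_pi_int (z : int) : sin (pi * z%:~R : R) = 0.
Proof.
have h (n : nat) : sin (pi * n%:R : R) = 0.
  by rewrite mulr_natr -[pi *+ n]add0r alternatingn ?sin0 ?mulr0//; exact: sinDpi.
by case: z => n; rewrite ?NegzE ?mulrNz ?mulrN ?sinN -?pmulrn h ?oppr0.
Qed.

Lemma cos_neq1 (x : R) : 0 < `|x| < 2 * pi -> cos x != 1.
Proof.
move=> /andP[x0 xpi]; rewrite -cos_norm; set y := `|x|.
have -> : y = (y / 2) *+ 2 by rewrite -mulr_natr divfK.
have : 0 < sin (y / 2).
  by apply: sin_gt0_pi; apply/andP; rewrite /y; split; lra.
rewrite cos_mulr2n cos2sin2 mulr2n => s0; rewrite lt_eqF//.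
have := mulr_gt0 s0 s0; lra.
Qed.

(* The sum of [F] over the integers of [-N, N). *)
Definition symm_sum (V : zmodType) (N : nat) (F : R -> V) : V :=
  \sum_(j < N) (F j%:R + F (- j.+1%:R)).

(** A geometric sum whose ratio is not 1, because its angle has absolute value strictly between 0
    and [2 pi]. Multiplied by the ratio minus 1 it telescopes to the difference of the exponentials
    at [pi z] and [- pi z], which coincide. *)
Lemma symm_sum_expi_eq0 (N : nat) (z : int) : (0 < `|z| < N.*2)%N ->
  symm_sum N (fun j => expi (pi * j / N%:R * z%:~R)) = 0.
Proof.
move=> /andP[z0 zN]; have N0 : (0 < N)%N by clear -zN; lia.
have N0' : N%:R != 0 :> R by rewrite pnatr_eq0 -lt0n.
pose a : R := pi * z%:~R / N%:R.
have w1 : expi a - 1 != 0 :> K.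
  rewrite subr_eq0; apply/negP => /eqP[ca _]; suff : cos a != 1 by rewrite ca eqxx.
  apply: cos_neq1; rewrite /a !normrM normfV gtr0_norm ?pi_gt0// (ger0_norm (ler0n _ _)).
  have pi0 := @pi_gt0 R.
  rewrite -intr_norm -abszE -pmulrn ltr_pdivrMr ?ltr0n// divr_gt0 ?mulr_gt0 ?ltr0n//=.
  rewrite [2 * _]mulrC -mulrA ltr_pM2l// -natrM ltr_nat mul2n//.
apply: (mulfI w1); rewrite mulr0 /symm_sum mulr_sumr.
pose E (j : R) : K := expi (a * j).
have step j : (expi a - 1) * E j = E (j + 1) - E j :> K.
  by rewrite mulrBl mul1r /E -expiD mulrDr mulr1 [a + _]addrC.
pose G (j : nat) : K := E j%:R - E (- j%:R).
transitivity (\sum_(j < N) (G j.+1 - G j) : K).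
  apply: eq_bigr => j _.
  have e u : pi * u / N%:R * z%:~R = a * u by rewrite /a; field.
  rewrite !e -!/(E _) mulrDr !step natr1.
  have -> : - j.+1%:R + 1 = - j%:R :> R by rewrite -natr1 opprD subrK.
  by rewrite /G; ring.
rewrite -(big_mkord xpredT (fun j => G j.+1 - G j)) telescope_sumr// /G /E.
have -> : a * N%:R = pi * z%:~R by rewrite /a; field.
have -> : a * - N%:R = - (pi * z%:~R) by rewrite /a; field.
rewrite oppr0 subrr subr0 /expi sinN cosN sin_pi_int oppr0.
exact: subrr.
Qed.

Definition pmf_law n (x : int) : R := rmean (law n) (fun k => ((k : int) == x)%:R).

Lemma symm_sum_wmean N (T : Type) (mu : seq (R * T)) (F : R -> T -> K) :
  symm_sum N (fun j => wmean mu (F j)) = wmean mu (fun x => symm_sum N (F^~ x)).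
Proof. by rewrite /symm_sum wmean_sum; apply: eq_bigr => j _; rewrite wmeanD. Qed.

(** Discrete Fourier inversion modulo [2 N]. The size condition excludes aliasing: points of the
    support differ from [x] by less than [2 N]. *)
Lemma pmf_law_inversion (n N : nat) (x : int) : (n ^ 2 + `|x| < N.*2)%N ->
  N.*2%:R * pmf_law n x = complex.Re (symm_sum N (fun j =>
    chf (law n) (pi * j / N%:R) * expi (- (pi * j / N%:R) * x%:~R) : K)).
Proof.
move=> nN.
transitivity (complex.Re (N.*2%:R * pmf_law n x *: (1 : K))).
  by rewrite /= mulr1.
congr complex.Re; rewrite -scalerA /pmf_law.
rewrite -wmean_scale -wmeanZ.
transitivity (wmean (law n) (fun k => symm_sum N
   (fun j => expi (pi * j / N%:R * (k%:Z - x)%:~R)) : K)).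
  apply: (eq_wmean_all (V := K : lmodType R) (P := fun k => (k <= n ^ 2)%N)
    (quicksort_law_support R n)).
  move=> k kn; have [<-|kx] := eqVneq (k : int) x.
    rewrite scale1r subrr /symm_sum (eq_bigr (fun=> 1 + 1)) => [|j _].
      by rewrite sumr_const card_ord -mulr2n -mulrnA mul2n scaler_nat.
    by rewrite !mulr0 expi0.
  rewrite scale0r scaler0 symm_sum_expi_eq0//; apply/andP; split.
    by rewrite absz_gt0 subr_eq0.
  by move: nN kn; move: (n ^ 2)%N => q; clear; lia.
rewrite -symm_sum_wmean; congr symm_sum; apply/funext => j.
rewrite (mulrC (chf _ _)) -wmean_mull; apply: (eq_wmean _ (V := K : lmodType R)) => k.
by rewrite -expiD; congr expi; rewrite rmorphB /= -pmulrn; ring.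
Qed.

Definition fourier_term n (y t : R) : K :=
  centered_chf n (t / n%:R) * expi (- (t * y)).

(** With [n * L] in place of [N], the rescaled frequencies form the mesh [pi j / L], which does not
    depend on [n]; sums for two sizes can then be compared term by term. *)
Lemma pmf_law_fourier (n L : nat) (x : int) : (0 < n)%N -> (0 < L)%N ->
    (n ^ 2 + `|x| < (n * L).*2)%N ->
  n%:R * pmf_law n x = (2 * L%:R)^-1 * complex.Re (symm_sum (n * L)
    (fun j => fourier_term n ((x%:~R - qmean R n) / n%:R) (pi * j / L%:R))).
Proof.
move=> n0 L0 nL; have L0' : L%:R != 0 :> R by rewrite pnatr_eq0 -lt0n.
have n0' : n%:R != 0 :> R by rewrite pnatr_eq0 -lt0n.
have L2 : 2 * L%:R != 0 :> R by rewrite mulf_neq0// pnatr_eq0.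
apply: (mulfI L2); rewrite mulVKf//.
have -> : 2 * L%:R * (n%:R * pmf_law n x) = (n * L).*2%:R * pmf_law n x.
  by rewrite -mul2n !natrM; ring.
rewrite pmf_law_inversion//; congr complex.Re; congr symm_sum; apply/funext => j.
rewrite /fourier_term (mulrC (chf _ _)) (mulrC (centered_chf _ _)) -!wmean_mull.
apply: (eq_wmean _ (V := K : lmodType R)) => k; rewrite -!expiD natrM; congr expi.
by field; apply/andP; split.
Qed.

Lemma symm_sum_le (N : nat) (F G : R -> R) : (forall j, `|j| <= N%:R -> F j <= G j) ->
  symm_sum N F <= symm_sum N G.
Proof.
move=> FG; apply: ler_sum => j _; apply: lerD; apply: FG.
  by rewrite ger0_norm// ler_nat ltnW.
by rewrite normrN ger0_norm// ler_nat.
Qed.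

Lemma symm_sum_norm (N : nat) (F : R -> K) :
  `|symm_sum N F| <= symm_sum N (fun j => `|F j|).
Proof.
apply: le_trans (ler_norm_sum _ _ _) _; apply: ler_sum => j _.
exact: ler_normD.
Qed.

Lemma symm_sum_widen (V : zmodType) (N M : nat) (F : R -> V) : (N <= M)%N ->
  symm_sum N F = symm_sum M (fun j => if - N%:R <= j < N%:R then F j else 0).
Proof.
move=> NM; rewrite /symm_sum.
rewrite (big_ord_widen _ (fun j => F j%:R + F (- j.+1%:R)) NM) big_mkcond /=.
apply: eq_bigr => j _; rewrite lerN2 !ltr_nat ler_nat.
rewrite (le_trans (_ : - N%:R <= 0)) ?oppr_le0//= (lt_le_trans (_ : _ < 0))// ?oppr_lt0//.
by rewrite andbT; case: ltnP => // _; rewrite addr0.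
Qed.

Lemma symm_sum_lorentz (N L : nat) : (0 < L)%N ->
  symm_sum N (fun j : R => (1 + (j / L%:R) ^+ 2)^-1) <= 8 * L%:R.
Proof.
move=> L0; have L1 : 1 <= L%:R :> R by rewrite ler1n.
set F := fun j : R => _.
have F_le i j : 0 <= i -> i <= j -> F j <= F i.
  move=> i0 ij; rewrite lef_pV2 ?posrE ?ltr_pwDl ?sqr_ge0// lerD2l.
  rewrite lerXn2r ?nnegrE ?divr_ge0//; last by rewrite ler_wpM2r ?invr_ge0.
  exact: le_trans ij.
have FN j : F (- j) = F j by rewrite /F mulNr sqrrN.
apply: (@le_trans _ _ (2 * \sum_(j < N) F j%:R)).
  rewrite mulr_sumr; apply: ler_sum => j _; rewrite FN.
  have := F_le j%:R j.+1%:R (ler0n _ _); rewrite ler_nat leqnSn => /(_ erefl); lra.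
(* The majorant increases by [4 L^2 / ((L + N) (L + N + 1))] at each step, which dominates the term
   [L^2 / (L^2 + N^2)]. *)
suff h : \sum_(j < N) F j%:R <= 4 * L%:R - 4 * L%:R ^+ 2 / (L%:R + N%:R).
  have : 0 <= 4 * L%:R ^+ 2 / (L%:R + N%:R) :> R.
    by rewrite divr_ge0 ?addr_ge0// mulr_ge0 ?sqr_ge0.
  lra.
elim: N => [|N IH].
  by rewrite big_ord0 addr0 expr2 mulrA mulfK ?subrr// lt0r_neq0// (lt_le_trans ltr01).
have FE : F N%:R = L%:R ^+ 2 / (L%:R ^+ 2 + N%:R ^+ 2).
  have : 0 <= N%:R :> R by []. move=> N0; rewrite /F; field.
  by rewrite !lt0r_neq0//; nra.
have BB : N%:R <= N%:R ^+ 2 :> R by rewrite -natrX ler_nat; clear; nia.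
have B0 : 0 <= N%:R :> R by [].
rewrite big_ord_recr /= FE -natr1; move: L1 IH BB B0.
set A := L%:R; set B := N%:R; set S := \sum_(_ < _) _; clear => L1 IH BB B0.
apply: (@le_trans _ _ (4 * A - 4 * A ^+ 2 / (A + B) + 4 * A ^+ 2 / ((A + B) * (A + (B + 1))))).
  have Q0 : 0 < (A + B) * (A + (B + 1)) by rewrite mulr_gt0//; lra.
  have P0 : 0 < A ^+ 2 + B ^+ 2 by nra.
  have QP : (A + B) * (A + (B + 1)) <= 4 * (A ^+ 2 + B ^+ 2).
    by have := sqr_ge0 (A - B); nra.
  apply: lerD => //; rewrite ler_pdivrMr// mulrAC ler_pdivlMr//.
  have -> : 4 * A ^+ 2 * (A ^+ 2 + B ^+ 2) = A ^+ 2 * (4 * (A ^+ 2 + B ^+ 2)) by ring.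
  by apply: ler_wpM2l => //; exact: sqr_ge0.
rewrite le_eqVlt; apply/orP; left; apply/eqP; field.
by apply/andP; split; rewrite lt0r_neq0//; lra.
Qed.
End FourierInversion.

(** * Comparison of the point probabilities at two sizes *)

Section LocalComparison.
Variable R : realType.
Local Notation K := (Rcomplex R).
Local Notation cnorm z := (`|z : Rcomplex R|).
Local Notation law := (quicksort_law R).

(** This is [n ^ (-1/4)], in the form in which interpolation produces it from the rate
    [n ^ (-1/2)]. *)
Definition rate (n : nat) : R := Num.sqrt (Num.sqrt n%:R)^-1.

Lemma rate_ge0 n : 0 <= rate n.
Proof. exact: sqrtr_ge0. Qed.

Lemma invn_le_rate n : (0 < n)%N -> n%:R^-1 <= rate n.
Proof.
move=> n0; have n1 : 1 <= n%:R :> R by rewrite ler1n.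
have nn : n%:R <= n%:R ^+ 2 :> R by rewrite expr2 ler_peMr.
rewrite -[leLHS]ger0_norm ?invr_ge0// -sqrtr_sqr ler_wsqrtr// exprVn.
rewrite lef_pV2 ?posrE ?sqrtr_gt0 ?exprn_gt0 ?(lt_le_trans ltr01)//.
rewrite -[leRHS]ger0_norm ?sqr_ge0// -sqrtr_sqr ler_wsqrtr//.
by apply: le_trans nn _; rewrite [leRHS]expr2 ler_peMr ?sqr_ge0// exprn_ege1.
Qed.

Lemma norm_centered_chf n t : `|centered_chf n t| = `|chf (law n) t|.
Proof.
suff -> : centered_chf n t = expi (- (t * qmean R n)) * chf (law n) t :> K.
  by rewrite cnormM norm_expi mul1r.
rewrite /chf -wmean_mull; apply: (eq_wmean _ (V := K : lmodType R)) => x.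
by rewrite -expiD; congr expi; ring.
Qed.

Variables A C : R.
Hypothesis A_ge0 : 0 <= A.
Hypothesis chf_close : forall n m t, (0 < n)%N -> (n <= m)%N ->
  cnorm (centered_chf m (t / m%:R) - centered_chf n (t / n%:R)) <=
  A * (1 + t ^+ 2) / Num.sqrt n%:R.
Hypothesis chf_decay : forall t, `|t| <= pi -> forall n,
  `|chf (law n) t| * (1 + (n%:R * t) ^+ 2) ^+ 3 <= C.

Lemma centered_chf_decay n t : (0 < n)%N -> `|t| <= pi * n%:R ->
  `|centered_chf n (t / n%:R)| * (1 + t ^+ 2) ^+ 3 <= C.
Proof.
move=> n0 tn; have n0' : 0 < n%:R :> R by rewrite ltr0n.
rewrite norm_centered_chf -{2}(divfK (lt0r_neq0 n0') t) [_ / _ * _]mulrC.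
apply: chf_decay; rewrite normrM normfV (gtr0_norm n0').
by rewrite ler_pdivrMr.
Qed.

Lemma decay_const_ge0 : 0 <= C.
Proof.
apply: le_trans (chf_decay (t := 0) _ 0); last by rewrite normr0 pi_ge0.
by rewrite mulr_ge0// exprn_ge0// addr_ge0// sqr_ge0.
Qed.

(** Interpolation: multiplying the closeness bound [A (1 + t^2) n^(-1/2)] by the decay bound
    [2 C (1 + t^2)^(-3)] bounds the square of the difference. Half of the rate is traded for
    summability in [t]. *)
Lemma centered_chf_close_decay n m t : (0 < n)%N -> (n <= m)%N -> `|t| <= pi * n%:R ->
  cnorm (centered_chf m (t / m%:R) - centered_chf n (t / n%:R)) * (1 + t ^+ 2) <=
  Num.sqrt (2 * A * C) * rate n.
Proof.
move=> n0 nm tn; have m0 : (0 < m)%N by exact: leq_trans nm.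
have tm : `|t| <= pi * m%:R.
  by apply: le_trans tn _; rewrite ler_wpM2l ?pi_ge0// ler_nat.
have h1 := chf_close t n0 nm.
have h2 := centered_chf_decay n0 tn; have h3 := centered_chf_decay m0 tm.
have h4 := ler_normB (centered_chf m (t / m%:R) : K) (centered_chf n (t / n%:R)).
move: h1 h2 h3 h4; set D := `|_ - _|; set a := `|centered_chf n _|.
set b := `|centered_chf m _| => h1 h2 h3 h4.
have D0 : 0 <= D by exact: normr_ge0.
have := sqr_ge0 t; move: h1 h2 h3; set s := t ^+ 2 => h1 h2 h3 s0.
have h5 : D * (1 + s) ^+ 3 <= 2 * C.
  have : D * (1 + s) ^+ 3 <= (b + a) * (1 + s) ^+ 3.
    by rewrite ler_wpM2r// exprn_ge0// addr_ge0.
  lra.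
have C0 := decay_const_ge0.
rewrite -sqrtrM ?mulr_ge0// -[leLHS]ger0_norm ?mulr_ge0 ?addr_ge0//.
rewrite -sqrtr_sqr ler_wsqrtr//.
set u := (Num.sqrt n%:R)^-1 in h1 *; have u0 : 0 <= u by rewrite invr_ge0 sqrtr_ge0.
have e : (D * (1 + s)) ^+ 2 * (1 + s) ^+ 2 =  D * (D * (1 + s) ^+ 3) * (1 + s) by ring.
have s1 : 1 <= 1 + s by lra.
have s20 : 0 < (1 + s) ^+ 2 by rewrite exprn_gt0//; lra.
rewrite -(ler_pM2r s20) e.
have -> : 2 * A * C * u * (1 + s) ^+ 2 = (A * (1 + s) * u) * (2 * C) * (1 + s) by ring.
rewrite ler_wpM2r ?addr_ge0// ler_pM//.
by rewrite mulr_ge0// exprn_ge0// addr_ge0.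
Qed.

Lemma fourier_term_close n m y y' t : (0 < n)%N -> (n <= m)%N -> `|t| <= pi * n%:R ->
  cnorm (fourier_term m y' t - fourier_term n y t) * (1 + t ^+ 2) <=
  Num.sqrt (2 * A * C) * rate n + 2 * C * `|y' - y|.
Proof.
move=> n0 nm tn; rewrite /fourier_term.
set a := centered_chf m _; set b := centered_chf n _.
have -> : a * expi (- (t * y')) - b * expi (- (t * y)) =
  (a - b) * expi (- (t * y')) + b * (expi (- (t * y')) - expi (- (t * y))) :> K by ring.
have s0 : 0 <= 1 + t ^+ 2 by rewrite addr_ge0// sqr_ge0.
apply: le_trans (ler_wpM2r s0 (ler_normD _ _)) _.
rewrite mulrDl !cnormM norm_expi mulr1; apply: lerD.
  exact: centered_chf_close_decay.
have hb := centered_chf_decay n0 tn.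
have he := norm_expiB (- (t * y')) (- (t * y)).
have {}he : cnorm (expi (- (t * y')) - expi (- (t * y))) <= 2 * (`|t| * `|y' - y|).
  by apply: le_trans he _; rewrite -opprD normrN -mulrBr normrM.
have tt : `|t| <= 1 + t ^+ 2.
  by rewrite -[t ^+ 2]real_normK ?num_real//; have := normr_ge0 t; nra.
have b0 : 0 <= `|b| by exact: normr_ge0.
apply: le_trans (_ : `|b| * (2 * ((1 + t ^+ 2) * `|y' - y|)) * (1 + t ^+ 2) <= _).
  apply: ler_wpM2r => //; apply: ler_wpM2l => //; apply: le_trans he _.
  by apply: ler_wpM2l => //; exact: ler_wpM2r.
apply: le_trans (_ : `|b| * (1 + t ^+ 2) ^+ 3 * (2 * `|y' - y|) <= _).
  have -> : `|b| * (2 * ((1 + t ^+ 2) * `|y' - y|)) * (1 + t ^+ 2) =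
     `|b| * (1 + t ^+ 2) ^+ 2 * (2 * `|y' - y|) by ring.
  apply: ler_wpM2r; first exact: mulr_ge0.
  by apply: ler_wpM2l => //; apply: ler_weXn2l => //; rewrite lerDl sqr_ge0.
have -> : 2 * C * `|y' - y| = C * (2 * `|y' - y|) by ring.
by rewrite ler_wpM2r ?mulr_ge0.
Qed.

(** These frequencies occur for the size [m] only. Decay alone suffices, since [1 + t^2 >= n]
    there. *)
Lemma fourier_term_tail n m y t : (0 < n)%N -> (n <= m)%N ->
    pi * n%:R <= `|t| -> `|t| <= pi * m%:R ->
  `|fourier_term m y t| * (1 + t ^+ 2) <= C * rate n.
Proof.
move=> n0 nm nt tm; rewrite /fourier_term cnormM norm_expi mulr1.
have h := centered_chf_decay (leq_trans n0 nm) tm.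
have n1 : 1 <= n%:R :> R by rewrite ler1n.
have pi2 := @pi_ge2 R.
have t2 : n%:R <= 1 + t ^+ 2.
  rewrite -[t ^+ 2]real_normK ?num_real//.
  have : n%:R <= `|t| by apply: le_trans nt; rewrite ler_peMl//; lra.
  by move=> ?; nra.
have c0 : 0 <= `|centered_chf m (t / m%:R)| by exact: normr_ge0.
apply: le_trans (_ : `|centered_chf m (t / m%:R)| * (1 + t ^+ 2) ^+ 3 * n%:R^-1 <= _).
  rewrite ler_pdivlMr ?(lt_le_trans ltr01)//.
  have -> : (1 + t ^+ 2) ^+ 3 = (1 + t ^+ 2) * ((1 + t ^+ 2) * (1 + t ^+ 2)) by ring.
  have s0 : 0 <= 1 + t ^+ 2 by rewrite addr_ge0// sqr_ge0.
  rewrite [leRHS]mulrA; apply: ler_wpM2l; first exact: mulr_ge0.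
  by rewrite (le_trans t2)// ler_peMl ?addr_ge0 ?sqr_ge0// lerDl sqr_ge0.
apply: ler_pM => //; last exact: invn_le_rate.
by rewrite mulr_ge0// exprn_ge0// addr_ge0 ?sqr_ge0.
Qed.

Lemma pmf_law_comparison n m (x x' : int) : (0 < n)%N -> (n <= m)%N ->
  `|m%:R * pmf_law R m x' - n%:R * pmf_law R n x| <=
  4 * ((Num.sqrt (2 * A * C) + C) * rate n +
  2 * C * `|(x'%:~R - qmean R m) / m%:R - (x%:~R - qmean R n) / n%:R|).
Proof.
move=> n0 nm; have m0 : (0 < m)%N by exact: leq_trans nm.
set y := (x%:~R - _) / _; set y' := (x'%:~R - _) / _.
(* A mesh fine enough to exclude aliasing at both sizes. It leaves no trace in the bound: the
   Lorentzian sum is at most [8 L] and the prefactor is [1 / (2 L)], whence the factor 4. *)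
pose L := (n ^ 2 + m ^ 2 + `|x| + `|x'|)%N.+1.
have hn : (n ^ 2 + `|x| < (n * L).*2)%N.
  rewrite /L; move: (n ^ 2)%N (m ^ 2)%N `|x|%N `|x'|%N => p q u v; clear -n0; nia.
have hm : (m ^ 2 + `|x'| < (m * L).*2)%N.
  rewrite /L; move: (n ^ 2)%N (m ^ 2)%N `|x|%N `|x'|%N => p q u v; clear -m0; nia.
rewrite (@pmf_law_fourier R n L x n0 (ltn0Sn _) hn).
rewrite (@pmf_law_fourier R m L x' m0 (ltn0Sn _) hm) -/y -/y'.
have L0 : 0 < L%:R :> R by rewrite ltr0n.
have nmL : (n * L <= m * L)%N by rewrite leq_mul2r nm orbT.
(* The shorter sum is padded with zeros, so the remaining terms of the longer one are treated as a
   tail. *)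
rewrite (symm_sum_widen _ nmL) -mulrBr normrM ger0_norm ?invr_ge0 ?mulr_ge0//.
rewrite mulrC ler_pdivrMr ?mulr_gt0//.
pose B : R := (Num.sqrt (2 * A * C) + C) * rate n + 2 * C * `|y' - y|; rewrite -/B.
have ReB (z w : K) : complex.Re z - complex.Re w = complex.Re (z - w : K) by case: z; case: w.
rewrite ReB; apply: le_trans (cnorm_Re _) _.
have symm_sumB N (F G : R -> K) :
    symm_sum N F - symm_sum N G = symm_sum N (fun j => F j - G j).
  by rewrite /symm_sum -sumrB; apply: eq_bigr => j _; rewrite addrACA -opprD.
rewrite symm_sumB; apply: le_trans (symm_sum_norm _ _) _.
have B0 : 0 <= B.
  by rewrite addr_ge0 ?mulr_ge0 ?addr_ge0 ?sqrtr_ge0 ?rate_ge0 ?decay_const_ge0.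
apply: (@le_trans _ _ (symm_sum (m * L) (fun j => B * (1 + (j / L%:R) ^+ 2)^-1))).
  apply: symm_sum_le => j jm.
  pose t := pi * j / L%:R; rewrite -/t.
  have pi2 := @pi_ge2 R.
  have tE : `|t| * L%:R = pi * `|j|.
    by rewrite /t !normrM normfV (gtr0_norm L0) mulfVK ?lt0r_neq0// gtr0_norm ?pi_gt0.
  have jt : (j / L%:R) ^+ 2 <= t ^+ 2.
    rewrite -(real_normK (num_real (j / _))) -[t ^+ 2]real_normK ?num_real//.
    rewrite lerXn2r ?nnegrE// normrM normfV (gtr0_norm L0) ler_pdivrMr// tE.
    by rewrite ler_peMl//; lra.
  have s0 u : 0 < 1 + u ^+ 2 :> R by rewrite ltr_pwDl// sqr_ge0.
  rewrite ler_pdivlMr//.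
  have tk k : (`|t| <= pi * k%:R) = (`|j| <= (k * L)%N%:R).
    by rewrite -(ler_pM2r L0) tE -mulrA ler_pM2l ?pi_gt0// natrM.
  apply: (@le_trans _ _ (`|fourier_term m y' t -
    (if - (n * L)%:R <= j < (n * L)%:R then fourier_term n y t else 0) : K| * (1 + t ^+ 2))).
    by rewrite ler_wpM2l// lerD2l.
  case: ifPn => [/andP[j1 j2]|].
    apply: le_trans (fourier_term_close y y' n0 nm _) _.
      by rewrite tk ler_norml j1 ltW.
    rewrite lerD2r ler_wpM2r ?rate_ge0// lerDl; exact: decay_const_ge0.
  rewrite negb_and -ltNge -leNgt subr0 => jn.
  apply: le_trans (fourier_term_tail y' n0 nm _ _) _.
  - rewrite -(ler_pM2r L0) tE -mulrA ler_pM2l ?pi_gt0// -natrM ler_normr.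
    by case/orP: jn => [/ltW|->//]; rewrite lerNr => ->; rewrite orbT.
  - by rewrite tk.
  - rewrite -[leLHS]addr0 lerD ?mulr_ge0 ?decay_const_ge0//.
    by rewrite ler_wpM2r ?rate_ge0// lerDr sqrtr_ge0.
have := @symm_sum_lorentz R (m * L) L (ltn0Sn _).
set S := symm_sum _ _ => hS.
have -> : symm_sum (m * L) (fun j : R => B * (1 + (j / L%:R) ^+ 2)^-1) = B * S.
  by rewrite /S /symm_sum mulr_sumr; apply: eq_bigr => j _; rewrite mulrDr.
apply: le_trans (ler_wpM2l B0 hS) _; rewrite le_eqVlt; apply/orP; left; apply/eqP; ring.
Qed.
End LocalComparison.
(** * Identification of the laws *)

Section DiscreteProbability.
Context d (T : measurableType d) (R : realType) (P : probability T R).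
Implicit Types (A B : set T).

Lemma measure_bigsetU_seq (I : eqType) (s : seq I) (C : I -> set T) : uniq s ->
    (forall i, measurable (C i)) -> (forall i j, i != j -> C i `&` C j = set0) ->
  P (\big[setU/set0]_(i <- s) C i) = (\sum_(i <- s) P (C i))%E.
Proof.
move=> us mC dC; elim: s us => [|i s IH] /=; first by rewrite !big_nil measure0.
case/andP=> is_ us; rewrite !big_cons measureU//.
- by congr (_ + _)%E; exact: IH.
- exact: bigsetU_measurable.
- rewrite big_distrr /= big_seq big1// => j js; apply: dC.
  by apply: contraNneq is_ => ->.
Qed.

Lemma fineK_probability A : measurable A -> (fine (P A))%:E = P A.
Proof. by move=> mA; rewrite fineK ?fin_num_measure. Qed.

(** The cells may fail to cover the space, but their masses sum to 1, so what they miss is null. *)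
Lemma probability_cells (I : finType) (C : I -> set T) (b : pred I) A :
    measurable A -> (forall i, measurable (C i)) ->
    (forall i j, i != j -> C i `&` C j = set0) ->
    \sum_i fine (P (C i)) = 1 ->
    (forall i, b i -> C i `<=` A) -> (forall i, ~~ b i -> C i `<=` ~` A) ->
  fine (P A) = \sum_(i | b i) fine (P (C i)).
Proof.
move=> mA mC dC C1 bA nbA.
have h (p : pred I) (S : set T) : measurable S -> (forall i, p i -> C i `<=` S) ->
    \sum_(i | p i) fine (P (C i)) <= fine (P S).
  move=> mS pS; rewrite -lee_fin fineK_probability// -sumEFin.
  under eq_bigr do rewrite fineK_probability//.
  rewrite -big_filter -measure_bigsetU_seq ?filter_uniq ?index_enum_uniq//.
  apply: le_measure; [|exact/mem_set|].
    by apply/mem_set; apply: bigsetU_measurable => i _; exact: mC.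
  rewrite big_filter; apply: (big_ind (fun B => B `<=` S)) => //.
  by move=> B1 B2 h1 h2; rewrite subUset.
(* The upper bound is the lower bound for the complement. *)
apply/eqP; rewrite eq_le h// andbT.
have := h (predC b) (~` A) (measurableC mA) nbA.
have -> : fine (P (~` A)) = 1 - fine (P A).
  by rewrite probability_setC// -[in LHS]fineK_probability// -EFinB.
by move: C1; rewrite (bigID b)/= => C1 h'; lra.
Qed.

Lemma ae_cst_law (X : {RV P >-> R}) (c : R) (E : set R) : measurable E ->
  {ae P, forall w, X w = c} -> P (X @^-1` E) = ((c \in E)%:R)%:E.
Proof.
move=> mE Xc; have mX : measurable (X @^-1` E).
  by rewrite -[X @^-1` E]setTI; exact: measurable_funP.
have [cE|cE] := boolP (c \in E).
  have : P (~` (X @^-1` E)) = 0%E.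
    apply: measure_negligible; first exact: measurableC.
    apply: negligibleS Xc => w /= nE Xw; apply: nE; rewrite Xw.
    exact: set_mem.
  rewrite probability_setC// -fineK_probability// -EFinB => -[] h.
  by congr EFin; rewrite /=; lra.
apply: measure_negligible => //; apply: negligibleS Xc => w /= wE Xw.
by move/negP: cE; apply; rewrite -Xw; exact: mem_set.
Qed.

End DiscreteProbability.

Section QuicksortDistribution.
Variable R : realType.
Local Notation law := (quicksort_law R).

Lemma rmean_quicksort_pmf n N (f : nat -> R) : (n ^ 2 < N)%N ->
  rmean (law n) f = \sum_(a < N) rmean (law n) (fun k => (k == a)%:R) * f a.
Proof.
move=> nN.
transitivity (rmean (law n) (fun k => \sum_(a < N) (k == a)%:R * f a)).
  apply: (eq_wmean_all (V := R^o) (P := fun k => (k < N)%N)) => [|k kN].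
    by apply: sub_all (quicksort_law_support R n) => p /leq_ltn_trans; apply.
  rewrite (bigD1 (Ordinal kN))//= eqxx mul1r big1 ?addr0// => a ak.
  by rewrite (_ : (k == a) = false) ?mul0r//; apply: contraNF ak => /eqP ka;
    apply/eqP/val_inj.
rewrite rmean_sum; apply: eq_bigr => a _; rewrite [RHS]mulrC -rmeanZ.
by apply: eq_rmean => k; rewrite mulrC.
Qed.

(** The cells fix the pivot rank and the costs of the two copies it selects. Independence factors
    their masses, which are then the weights of [mixture]. *)
Lemma quicksort_step_law d (T : measurableType d) (P : probability T R)
    (Q : nat -> {RV P >-> R}) (n : nat) : quicksort_step Q n.+1 ->
    (forall j, (j <= n)%N -> forall E, measurable E ->
      fine (P (Q j @^-1` E)) = rmean (law j) (fun k => (k%:R \in E)%:R)) ->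
  forall E, measurable E ->
    fine (P (Q n.+1 @^-1` E)) = rmean (law n.+1) (fun k => (k%:R \in E)%:R).
Proof.
move=> [d' [T' [P' [U [A [B [hU hAB hind hQ]]]]]]] IH E mE.
rewrite hQ//; set Z := _ @^-1` E.
(* The values below [N] carry the whole mass of every law of index at most [n]. *)
pose N := (n ^ 2).+1.
pose I := ('I_n.+1 * ('I_N * 'I_N))%type.
pose CU (i : 'I_n.+1) : set T' := U @^-1` [set i.+1].
pose CA (i : 'I_n.+1) (a : 'I_N) : set T' := A i @^-1` [set a%:R].
pose CB (i : 'I_n.+1) (a : 'I_N) : set T' := B (n - i)%N @^-1` [set a%:R].
pose C (t : I) : set T' := CU t.1 `&` (CA t.1 t.2.1 `&` CB t.1 t.2.2).
have mCU i : measurable (CU i) by rewrite -[CU i]setTI; exact: measurable_funP.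
have mX (X : {RV P' >-> R}) S : measurable S -> measurable (X @^-1` S).
  by move=> mS; rewrite -[_ @^-1` _]setTI; exact: measurable_funP.
have mC t : measurable (C t) by do 2?[apply: measurableI => //]; exact: mX.
have mZ : measurable Z.
  (* The indices of [A] and [B] are random; measurability follows by splitting along the countably
     many values of [U]. *)
  rewrite (_ : Z = \bigcup_k (U @^-1` [set k] `&`
      ((A (k - 1)%N \+ (B (n.+1 - k)%N \+ cst (n.+1 - 1)%:R)) @^-1` E))).
    apply: bigcup_measurable => k _; apply: measurableI.
      by rewrite -[_ @^-1` _]setTI; exact: measurable_funP.
    have mf : measurable_fun [set: T']
        (A (k - 1)%N \+ (B (n.+1 - k)%N \+ cst (n.+1 - 1)%:R)).
      by apply: measurable_funD => //; apply: measurable_funD => //; exact: measurable_cst.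
    by rewrite -[_ @^-1` E]setTI; exact: mf.
  apply/seteqP; split => [w Zw|w [k _ [/= Uk]]] /=.
    by exists (U w) => //; split => //=; rewrite addrA.
  by rewrite /Z /= Uk addrA.
have dC s t : s != t -> C s `&` C t = set0.
  move=> st; apply/seteqP; split => // w [[/= u1 [a1 b1]] [/= u2 [a2 b2]]].
  move/eqP: st; apply; move: s t u1 a1 b1 u2 a2 b2 => [i [a b]] [j [a' b']] /=.
  move=> u1 a1 b1 u2 a2 b2; have ij : i = j.
    by apply/val_inj/succn_inj; rewrite -u1 -u2.
  rewrite -ij in a2 b2 *; congr (_, (_, _)); apply/val_inj/eqP;
    by rewrite -(eqr_nat R) -?a1 -?a2 -?b1 -?b2.
pose p j a : R := rmean (law j) (fun k => (k == a)%:R).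
have pE j a : rmean (law j) (fun k => (k%:R \in [set a%:R : R])%:R) = p j a.
  apply: eq_rmean => k; congr (nat_of_bool _)%:R.
  by apply/idP/eqP => [/set_mem/eqP|->]; [rewrite eqr_nat => /eqP | exact/mem_set].
have PA j a : (j <= n)%N -> fine (P' (A j @^-1` [set a%:R])) = p j a.
  move=> jn; have [<- //] := hAB j jn.
  by rewrite IH.
have PB j a : (j <= n)%N -> fine (P' (B j @^-1` [set a%:R])) = p j a.
  move=> jn; have [_ <- //] := hAB j jn.
  by rewrite IH.
have PC t : fine (P' (C t)) = n.+1%:R^-1 * (p t.1 t.2.1 * p (n - t.1)%N t.2.2).
  move: t => [i [a b]] /=.
  have ni : (n - i < n.+1)%N by rewrite ltnS leq_subr.
  pose EV (o : option ('I_n.+1 + 'I_n.+1)) : set T' :=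
    match o with
    | None => CU i
    | Some (inl j) => A j @^-1` [set (a : nat)%:R]
    | Some (inr j) => B j @^-1` [set (b : nat)%:R]
    end.
  (* The tags of the index type keep the two copies distinct even when [i = n - i]. *)
  have := hind (None |` (Some (inl i) |` [fset Some (inr (Ordinal ni))]))%fset EV.
  rewrite !bigcap_fsetU1 bigcap_fset big_seq_fset1 !big_fsetU1 ?inE//= big_seq_fset1 /=.
  rewrite (PA i) ?leq_ord// (PB (n - i)%N) ?leq_subr// /CU hU ?ltn_ord//= => <- //.
  move=> [[j|j]|] _; rewrite /generated_events /EV.
  - by exists [set (a : nat)%:R] => //; rewrite setTI.
  - by exists [set (b : nat)%:R] => //; rewrite setTI.
  - by exists [set i.+1] => //; rewrite setTI.
have psum j : (j <= n)%N -> \sum_(a < N) p j a = 1.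
  move=> jn; rewrite -(rmean_quicksort_law1 R j) (rmean_quicksort_pmf (N := N)).
    by apply: eq_bigr => a _; rewrite mulr1.
  by rewrite ltnS leq_exp2r.
pose b (t : I) := (t.2.1 + t.2.2 + n)%N%:R \in E.
have sumI (F : I -> R) : \sum_t F t = \sum_i \sum_a \sum_c F (i, (a, c)).
  rewrite (eq_bigr (fun t => F (t.1, (t.2.1, t.2.2)))) => [|[? []]//].
  rewrite -(pair_bigA _ (fun i ac => F (i, (ac.1, ac.2)))) /=; apply: eq_bigr => i _.
  by rewrite -(pair_bigA _ (fun a c => F (i, (a, c)))).
have C1 : \sum_t fine (P' (C t)) = 1.
  rewrite sumI (eq_bigr (fun=> n.+1%:R^-1)) => [|i _].
    by rewrite sumr_const card_ord -[_ *+ _]mulr_natr mulVf ?pnatr_eq0.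
  rewrite (eq_bigr (fun a : 'I_N => n.+1%:R^-1 * p i a)) => [|a _].
    by rewrite -mulr_sumr psum ?mulr1 ?leq_ord.
  rewrite (eq_bigr (fun c : 'I_N => n.+1%:R^-1 * p i a * p (n - i)%N c)) => [|c _].
    by rewrite -mulr_sumr psum ?mulr1 ?leq_subr.
  by rewrite PC /= mulrA.
have CE t w : C t w -> (Z w <-> b t).
  move: t => [i [a c]] [/= u [ha hb]]; rewrite /b /= /Z /= u.
  have -> : (i.+1 - 1 = i)%N by rewrite subn1.
  rewrite subSS; have -> : A i w = (a : nat)%:R by [].
  have -> : B (n - i)%N w = (c : nat)%:R by [].
  by rewrite subn1 -!natrD; split=> [/mem_set|/set_mem].
rewrite (@probability_cells _ _ _ P' I C b Z) //; last 2 first.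
- by move=> t bt w /CE; rewrite bt => ->.
- by move=> t /negP nb w /CE h /h.
rewrite quicksort_lawS rmean_mixture big_mkcond sumI /=; apply: eq_bigr => i _.
rewrite (@rmean_quicksort_pmf i N); last by rewrite ltnS leq_exp2r// leq_ord.
rewrite mulr_sumr; apply: eq_bigr => x _; rewrite -/(p i x) (@rmean_quicksort_pmf (n - i) N); last first.
  by rewrite ltnS leq_exp2r// leq_subr.
rewrite !mulr_sumr; apply: eq_bigr => y _; rewrite PC /= /b /=.
by case: (_ \in E); rewrite ?mulr1 ?mulr0.
Qed.

Lemma quicksort_law_correct d (T : measurableType d) (P : probability T R)
    (Q : nat -> {RV P >-> R}) : quicksort_comparisons Q ->
  forall n E, measurable E ->
    fine (P (Q n @^-1` E)) = rmean (law n) (fun k => (k%:R \in E)%:R).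
Proof.
move=> [Q0 Q1 QS]; elim/ltn_ind => -[|[|n]] IH E mE.
- rewrite (ae_cst_law mE Q0) /= rmeanE big_seq1 mul1r//.
- rewrite (ae_cst_law mE Q1) /= quicksort_lawS rmean_mixture big_ord1 /= invr1 mul1r.
  by rewrite !rmeanE !big_seq1 !mul1r rmeanE big_seq1 mul1r.
- by apply: quicksort_step_law => //; exact: QS.
Qed.
End QuicksortDistribution.

(** * Point probabilities, mean and distribution function of the given variables *)

Section QuicksortVariables.
Context d (T : measurableType d) (R : realType) (P : probability T R).
Variable Qn : nat -> {RV P >-> R}.
Hypothesis hQn : quicksort_comparisons Qn.
Local Notation law := (quicksort_law R).

Lemma measurable_RV_preimage (X : {RV P >-> R}) (S : set R) :
  measurable S -> measurable (X @^-1` S).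
Proof. by move=> mS; rewrite -[_ @^-1` _]setTI; exact: measurable_funP. Qed.

Lemma pmf_quicksort n (x : int) : pmf (Qn n) x%:~R = pmf_law R n x.
Proof.
rewrite /pmf (quicksort_law_correct hQn)//; apply: eq_rmean => k.
congr (nat_of_bool _)%:R; apply/idP/eqP => [/set_mem/= h|<-].
  by apply: (@intr_inj R); rewrite -h -pmulrn.
exact: mem_set.
Qed.

(** Only the law is known, so the variable is a natural number at most [n ^ 2] almost surely; its
    integral is that of an almost everywhere equal simple function. *)
Lemma mean_quicksort n : mean (Qn n) = qmean R n.
Proof.
pose N := (n ^ 2).+1; pose X := Qn n.
pose C (a : 'I_N) : set T := X @^-1` [set (a : nat)%:R].
have mC a : measurable (C a) by exact: measurable_RV_preimage.
pose E : set R := \bigcup_(a in `I_N) [set a%:R].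
have mE : measurable E by apply: fin_bigcup_measurable => // a _; exact: measurable_set1.
have PE : P (~` (X @^-1` E)) = 0%E.
  rewrite probability_setC; last exact: measurable_RV_preimage.
  rewrite -fineK_probability; last exact: measurable_RV_preimage.
  rewrite (quicksort_law_correct hQn)//.
  have -> : rmean (law n) (fun k => (k%:R \in E)%:R) = 1.
    rewrite -[RHS](rmean_quicksort_law1 R n).
    apply: (eq_wmean_all (V := R^o) (P := fun k => (k <= n ^ 2)%N)
      (quicksort_law_support R n)) => k kn.
    by have Ek : E k%:R by [exists k]; rewrite mem_set.
  by rewrite -EFinB subrr.
rewrite /mean unlock.
have -> : (\int[P]_w (X w)%:E = \int[P]_w \sum_(a < N) (a%:R * \1_(C a) w)%:E)%E.
  apply: ae_eq_integral => //.
  - by apply/measurable_EFinP; exact: measurable_funP.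
  - apply: emeasurable_sum => a; apply/measurable_EFinP.
    by apply: measurable_funM => //; exact: measurable_indic.
  - exists (~` (X @^-1` E)); split => //; first by apply/measurableC/measurable_RV_preimage.
    move=> w /= nfg [a aN Xa]; apply: nfg => _.
    apply: (@etrans _ _ (a%:R)%:E); first by congr EFin; exact: Xa.
    rewrite (bigD1 (Ordinal aN))//= big1 => [|b ba].
      by rewrite indicE mem_set// mulr1 adde0.
    rewrite indicE memNset ?mulr0// => Xb; move/eqP: ba; apply; apply/val_inj/eqP.
    by rewrite -(eqr_nat R); apply/eqP; exact: etrans (esym Xb) Xa.
rewrite ge0_integral_sum//; last first.
- move=> a; apply/measurable_EFinP.
  by apply: measurable_funM => //; exact: measurable_indic.
transitivity (fine (\sum_(a < N) (a%:R * pmf_law R n a)%:E)).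
  congr fine; apply: eq_bigr => a _.
  rewrite (integralZl_indic measurableT (fun=> C a))// ?integral_indic// ?setIT.
    rewrite EFinM; congr (_ * _)%E; rewrite -pmf_quicksort /pmf -pmulrn.
    by apply/esym; exact: fineK_probability.
  by rewrite ltNge ler0n.
rewrite sumEFin /= /qmean (@rmean_quicksort_pmf _ n N)//.
by apply: eq_bigr => a _; rewrite mulrC; congr (_ * _); apply: eq_rmean => k.
Qed.

Definition interval_mass n (a b : R) : R :=
  rmean (law n) (fun x => (a < (x%:R - qmean R n) / n%:R <= b)%R%:R).

Lemma interval_mass_cdf n a b : (0 < n)%N -> a <= b ->
  interval_mass n a b =
  fine (P ((fun w => (Qn n w - mean (Qn n)) / n%:R) @^-1` `]-oo, b])) -
  fine (P ((fun w => (Qn n w - mean (Qn n)) / n%:R) @^-1` `]-oo, a])).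
Proof.
move=> n0 ab; have n0' : 0 < n%:R :> R by rewrite ltr0n.
have E c : (fun w => (Qn n w - mean (Qn n)) / n%:R) @^-1` `]-oo, c] =
    Qn n @^-1` `]-oo, c * n%:R + qmean R n].
  apply/seteqP; split => w /=; rewrite !in_itv/= mean_quicksort;
  by rewrite ler_pdivrMr// lerBlDr.
rewrite !E !(quicksort_law_correct hQn)// -rmeanB; apply: eq_rmean => x.
have inE' c : (x%:R \in `]-oo, c * n%:R + qmean R n]%classic) =
   ((x%:R - qmean R n) / n%:R <= c).
  rewrite ler_pdivrMr// lerBlDr; apply/idP/idP => [/set_mem|h]; last apply/mem_set.
    by rewrite /= in_itv.
  by rewrite /= in_itv.
rewrite !inE'; set z := _ / _.
have [za|az] := leP z a; last by rewrite subr0.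
by rewrite (le_trans za ab) subrr.
Qed.

End QuicksortVariables.
(** * The limit density *)

Section Density.
Context d (T : measurableType d) (R : realType) (P : probability T R).
Variables (Q : {RV P >-> R}) (f : R -> R).
Hypotheses (hf : is_density Q f) (hfc : continuous f).

Definition itv_prob (a b : R) : R := fine (P (Q @^-1` `]a, b])).

Lemma itv_prob_ge0 a b : 0 <= itv_prob a b.
Proof. exact/fine_ge0/measure_ge0. Qed.

Lemma itv_prob_bounds (a b m M : R) : a < b ->
    (forall x, a < x <= b -> m <= f x <= M) ->
  m * (b - a) <= itv_prob a b <= M * (b - a).
Proof.
move=> ab fmM; have [mf f0 fE] := hf.
have mI : measurable `]a, b]%classic := measurable_itv _.
have leb : lebesgue_measure (`]a, b]%classic : set R) = (b - a)%:E.
  by rewrite lebesgue_measure_itv /= lte_fin ab EFinB.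
have PE : (itv_prob a b)%:E = (\int[lebesgue_measure]_(x in `]a, b]) (f x)%:E)%E.
  by rewrite fineK_probability ?fE//; exact: measurable_RV_preimage.
have mfE : measurable_fun `]a, b]%classic (EFin \o f).
  by apply/measurable_EFinP; exact: measurable_funTS.
have cst (c : R) : (\int[lebesgue_measure]_(x in `]a, b]) c%:E)%E = (c * (b - a))%:E.
  by rewrite integral_cst// EFinM; congr (_ * _)%E.
have M0 : 0 <= M.
  have /fmM /andP[_ h] : a < b <= b by rewrite ab lexx.
  exact: le_trans (f0 b) h.
apply/andP; split.
- have [m0|m0] := leP 0 m; last first.
    by apply: le_trans (itv_prob_ge0 a b); rewrite mulr_le0_ge0 ?ltW// subr_gt0.
  rewrite -lee_fin PE -cst; apply: ge0_le_integral => //.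
  by move=> x /=; rewrite in_itv/= => /fmM /andP[h _]; rewrite lee_fin.
- rewrite -lee_fin PE -cst; apply: ge0_le_integral => //.
    by move=> x _; rewrite lee_fin.
  by move=> x /=; rewrite in_itv/= => /fmM /andP[_ h]; rewrite lee_fin.
Qed.

Lemma density_near (y e : R) : 0 < e -> exists2 r, 0 < r &
  forall x, `|x - y| < r -> `|f x - f y| <= e.
Proof.
move=> e0; have /cvgrPdist_le /(_ e e0) /nbhs_ballP[r /= r0 hr] := @hfc y.
by exists r => // x xy; rewrite distrC; apply: hr; rewrite /ball /= distrC.
Qed.

Lemma fine_cdfB a b : a <= b -> fine (cdf Q b) - fine (cdf Q a) = itv_prob a b.
Proof.
move=> ab; have mX S : measurable S -> measurable (Q @^-1` S).
  exact: measurable_RV_preimage.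
apply/eqP; rewrite subr_eq; apply/eqP.
have E : Q @^-1` `]-oo, b] = Q @^-1` `]a, b] `|` Q @^-1` `]-oo, a].
  apply/seteqP; split=> w /=; rewrite !in_itv/=.
    by move=> h; have [|h'] := leP (Q w) a; [right | left; apply/andP].
  by case=> [/andP[]//|/le_trans]; apply.
have -> : cdf Q b = P (Q @^-1` `]-oo, b]) by [].
have -> : cdf Q a = P (Q @^-1` `]-oo, a]) by [].
rewrite E measureU; [|exact: mX|exact: mX|].
  by rewrite fineD// fin_num_measure//; exact: mX.
apply/seteqP; split=> // w [/=]; rewrite !in_itv/= => /andP[h1 _] h2.
by move: (lt_le_trans h1 h2); rewrite ltxx.
Qed.

(** Makes convergence in distribution available at every point. Near [t] the density is at most
    [f t + 1], so the distribution function is Lipschitz there. *)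
Lemma continuous_cdf (t : R) : {for t, continuous (cdf Q)}.
Proof.
have cdfE : cdf Q = EFin \o (fine \o cdf Q).
  by apply/funext => s /=; rewrite fineK// fin_num_measure.
rewrite /prop_for /continuous_at cdfE.
apply: cvg_EFin; first by near=> s.
rewrite /=; apply/cvgrPdist_le => e e0.
have [r r0 hr] := density_near t ltr01.
have [_ f0 _] := hf.
have M0 : 0 < f t + 1 by rewrite ltr_wpDl.
have bound a b : a <= b -> `|a - t| < r -> `|b - t| < r ->
    `|fine (cdf Q b) - fine (cdf Q a)| <= (f t + 1) * (b - a).
  move=> ab ar br; rewrite fine_cdfB// ger0_norm ?itv_prob_ge0//.
  move: ab; rewrite le_eqVlt => /predU1P[<-|ab].
    by rewrite -fine_cdfB// !subrr mulr0.
  have [] := andP (@itv_prob_bounds a b 0 (f t + 1) ab _) => // x /andP[ax xb].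
  have := hr x; rewrite f0/=.
  have -> : `|x - t| < r.
    by rewrite ltr_norml; move: ar br; rewrite !ltr_norml => /andP[? ?] /andP[? ?]; lra.
  by move=> /(_ isT); rewrite ler_norml => /andP[_]; lra.
have q0 : 0 < Num.min r (e / (f t + 1)) by rewrite lt_min r0 divr_gt0.
near=> s.
have : `|s - t| < Num.min r (e / (f t + 1)).
  by rewrite distrC; near: s; exact: (@cvgr_dist_lt _ R _ _ _ id t cvg_id _ q0).
rewrite lt_min => /andP[sr]; rewrite ltr_pdivlMr// => se.
have tr : `|t - t| < r by rewrite subrr normr0.
have [st|ts] := leP s t.
  apply: le_trans (bound _ _ st sr tr) _; rewrite mulrC.
  by apply: le_trans (ltW se); rewrite ler_wpM2r ?(ltW M0)// distrC ler_norm.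
rewrite distrC; apply: le_trans (bound _ _ (ltW ts) tr sr) _; rewrite mulrC.
by apply: le_trans (ltW se); rewrite ler_wpM2r ?(ltW M0)// ler_norm.
Unshelve. all: by end_near. Qed.

Lemma density_gt0 : exists y, 0 < f y.
Proof.
have [mf f0 fE] := hf; apply: contrapT => /forallNP fN.
have fx0 x : f x = 0 by apply/eqP; rewrite eq_le f0 andbT leNgt; exact/negP/fN.
have := fE setT measurableT; rewrite preimage_setT probability_setT.
by under eq_integral do rewrite fx0; rewrite integral0 => /eqP; rewrite onee_eq0.
Qed.

End Density.

(** * The local limit theorem *)

Section LocalLimit.
Context (R : realType) d (T : measurableType d) (P : probability T R)
  (Qn : nat -> {RV P >-> R})
  d' (T' : measurableType d') (P' : probability T' R) (Q : {RV P' >-> R}) (f : R -> R).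
Hypotheses (hQn : quicksort_comparisons Qn)
  (hQ : cvg_in_distribution P (fun n w => (Qn n w - mean (Qn n)) / n%:R) Q)
  (hf : is_density Q f) (hfc : continuous f).
Local Notation law := (quicksort_law R).

Lemma interval_mass_cvg a b e : a <= b -> 0 < e ->
  exists N, forall m, (N <= m)%N -> `|interval_mass m a b - itv_prob Q a b| <= e.
Proof.
move=> ab e0; have e2 : 0 < e / 2 by rewrite divr_gt0.
have cdf_cvg t : exists N, forall m, (N <= m)%N ->
  `|fine (P ((fun w => (Qn m w - mean (Qn m)) / m%:R) @^-1` `]-oo, t]))
    - fine (cdf Q t)| <= e / 2.
  have := hQ (continuous_cdf hf hfc (t := t)).
  rewrite -[cdf Q t]fineK ?fin_num_measure// => /fine_cvg /cvgrPdist_le /(_ _ e2).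
  by move=> [N _ hN]; exists N => m Nm; rewrite distrC; exact: hN.
have [Na hNa] := cdf_cvg a; have [Nb hNb] := cdf_cvg b.
exists (maxn 1 (maxn Na Nb)) => m; rewrite !geq_max => /and3P[m0 am bm].
rewrite (interval_mass_cdf hQn m0 ab) -(fine_cdfB Q ab).
have := hNa m am; have := hNb m bm.
set A := fine (P _); set B := fine (P _); rewrite !ler_norml.
move=> /andP[? ?] /andP[? ?]; apply/andP; split; lra.
Qed.

(** To the right of a point [y] with [f y > 0], the density stays above [f y / 2] over a length [r],
    which holds two intervals of length [r / 4] a distance [r / 4] apart. Half of their limit mass
    is given up to pass to finite sizes. *)
Lemma quicksort_charges : exists a1 b1 a2 b2 p : R, exists N : nat,
  [/\ a1 < b2, b1 < a2, 0 < p, charges a1 b1 p N & charges a2 b2 p N].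
Proof.
have [y fy] := density_gt0 hf.
have fy2 : 0 < f y / 2 by rewrite divr_gt0.
have [r r0 hr] := density_near hfc y fy2.
pose s := r / 4; have s0 : 0 < s by rewrite divr_gt0.
have mass a b : y <= a -> b < y + r -> b - a = s -> exists N, charges a b (f y / 4 * s) N.
  move=> ya br bas; have ab : a < b by lra.
  have [] := andP (@itv_prob_bounds _ _ _ _ _ _ hf a b (f y / 2) (f y * 2) ab _).
    move=> x /andP[ax xb]; have := hr x; rewrite ger0_norm; last by lra.
    move=> /(_ (ltac:(lra))); rewrite ler_norml => /andP[? ?]; apply/andP; split; lra.
  rewrite bas => hl _; have e0 : 0 < f y / 4 * s by rewrite mulr_gt0// divr_gt0.
  have [N hN] := interval_mass_cvg (ltW ab) e0.
  exists N => m /hN; rewrite ler_norml => /andP[h _].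
  by rewrite -/(interval_mass m a b); lra.
have [N1 h1] := mass y (y + s) (lexx _) (ltac:(rewrite /s; lra)) (ltac:(lra)).
have [N2 h2] := mass (y + 2 * s) (y + 3 * s) (ltac:(lra)) (ltac:(rewrite /s; lra)) (ltac:(lra)).
exists y, (y + s), (y + 2 * s), (y + 3 * s), (f y / 4 * s), (maxn N1 N2); split.
- lra.
- lra.
- by rewrite mulr_gt0// divr_gt0.
- by move=> m; rewrite geq_max => /andP[/h1].
- by move=> m; rewrite geq_max => /andP[_ /h2].
Qed.

(** The interval holds [m * h] integers up to an error of 1, and each contributes [c] up to
    [eta]. *)
Lemma interval_mass_count m a h c eta : (0 < m)%N -> 0 <= h ->
    (forall x : int, a < (x%:~R - qmean R m) / m%:R <= a + h ->
       `|m%:R * pmf_law R m x - c| <= eta) -> 0 <= eta ->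
  `|m%:R * interval_mass m a (a + h) - m%:R * h * c| <= (m%:R * h + 1) * eta + `|c|.
Proof.
move=> m0 h0 hx eta0; have m0' : 0 < m%:R :> R by rewrite ltr0n.
pose lo := qmean R m + a * m%:R; pose hi := qmean R m + (a + h) * m%:R.
have lohi : lo <= hi by rewrite /lo /hi lerD2l ler_wpM2r// lerDl.
have inE' (x : int) : (a < (x%:~R - qmean R m) / m%:R <= a + h) =
    (Num.floor lo < x <= Num.floor hi).
  rewrite ltr_pdivlMr// ler_pdivrMr// ltrBrDl lerBlDl -/lo -/hi.
  by rewrite floor_lt_int floor_ge_int.
have fl : Num.floor lo <= Num.floor hi by exact: le_floor.
pose N := `|Num.floor hi - Num.floor lo|%N.
have NE : (N%:Z = Num.floor hi - Num.floor lo)%R by rewrite gez0_abs// subr_ge0.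
pose z (i : nat) : int := Num.floor lo + i.+1%:Z.
have massE : interval_mass m a (a + h) = \sum_(i < N) pmf_law R m (z i).
  rewrite /interval_mass /pmf_law -rmean_sum; apply: eq_rmean => k.
  have -> : (a < (k%:R - qmean R m) / m%:R <= a + h) =
      (Num.floor lo < k%:Z <= Num.floor hi) by exact: (inE' k%:Z).
  move: NE; rewrite /z; clear; move: (Num.floor lo) (Num.floor hi) N => u v N NE.
  have [/andP[uk kv]|ukv] := boolP (u < k%:Z <= v).
    have i0N : (`|k%:Z - u|.-1 < N)%N by clear -uk kv NE; lia.
    rewrite (bigD1 (Ordinal i0N))//= big1 => [|i ii0].
      rewrite addr0; suff -> : k%:Z == u + (`|k%:Z - u|.-1).+1%:Z by [].
      by apply/eqP; clear -uk; lia.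
    case: eqP => // kE; move/eqP: ii0; case; apply/val_inj => /=.
    by clear -kE; lia.
  rewrite big1// => i _; case: eqP => // kE; have iN := ltn_ord i.
  by move/negP: ukv; case; clear -kE iN NE; lia.
have NR : `|N%:R - m%:R * h| <= 1.
  have -> : N%:R = (Num.floor hi)%:~R - (Num.floor lo)%:~R :> R.
    by rewrite -rmorphB -NE.
  have /andP[h1 h2] := floor_itv hi; have /andP[l1 l2] := floor_itv lo.
  rewrite intrD in h2; rewrite intrD in l2.
  have e : hi - lo = m%:R * h by rewrite /hi /lo; ring.
  by rewrite ler_norml; apply/andP; split; lra.
rewrite massE mulr_sumr.
have -> : \sum_(i < N) m%:R * pmf_law R m (z i) - m%:R * h * c =
  \sum_(i < N) (m%:R * pmf_law R m (z i) - c) + (N%:R - m%:R * h) * c.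
  by rewrite sumrB sumr_const card_ord -[c *+ N]mulr_natl; ring.
apply: le_trans (ler_normD _ _) _; apply: lerD; last first.
  by rewrite normrM ler_piMl.
apply: le_trans (ler_norm_sum _ _ _) _.
apply: (@le_trans _ _ (\sum_(i < N) eta)).
  apply: ler_sum => i _; apply: hx; rewrite inE' /z; have := ltn_ord i.
  by move: NE; clear; lia.
rewrite sumr_const card_ord -[eta *+ N]mulr_natl ler_wpM2r//.
by move: NR; rewrite ler_norml => /andP[_]; lra.
Qed.

Lemma local_limit_scaled : exists B : R, forall n (x : int), (0 < n)%N ->
  `|n%:R * pmf_law R n x - f ((x%:~R - qmean R n) / n%:R)| <= B * rate R n.
Proof.
have [a1 [b1 [a2 [b2 [p [N [ab ba p0 c1 c2]]]]]]] := quicksort_charges.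
have [C hC] := norm_chf_quicksort_decay ab ba p0 c1 c2.
have [A A0 hA] := @centered_chf_close R.
pose B1 := 4 * (Num.sqrt (2 * A * C) + C); pose B2 := 8 * C.
have C0 := decay_const_ge0 hC.
have B20 : 0 <= B2 by rewrite mulr_ge0.
have cmp n m (x x' : int) (n0 : (0 < n)%N) (nm : (n <= m)%N) :
    `|m%:R * pmf_law R m x' - n%:R * pmf_law R n x| <= B1 * rate R n +
    B2 * `|(x'%:~R - qmean R m) / m%:R - (x%:~R - qmean R n) / n%:R|.
  apply: le_trans (pmf_law_comparison A0 hA hC x x' n0 nm) _.
  by rewrite le_eqVlt; apply/orP; left; apply/eqP; rewrite /B1 /B2; ring.
exists B1 => n x n0; set y := (x%:~R - _) / _; set c := n%:R * _.
have B10 : 0 <= B1 * rate R n.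
  by rewrite mulr_ge0 ?rate_ge0// mulr_ge0// addr_ge0 ?sqrtr_ge0.
(* With [n] and [x] fixed, an arbitrary slack [e] replaces the limits in [m] and then in [h]. *)
apply/ler_addgt0Pr => e e0.
have e8 : 0 < e / 8 by rewrite divr_gt0.
have [r r0 hr] := density_near hfc y e8.
(* The first bound keeps [f] within [e / 8] of [f y] on the interval, the second makes the drift
   [B2 * h] at most [e / 8]. *)
pose h := Num.min (r / 2) (e / (8 * (B2 + 1))).
have h0 : 0 < h by rewrite lt_min !divr_gt0// mulr_gt0// ltr_wpDl.
have hB : B2 * h <= e / 8.
  have : h <= e / (8 * (B2 + 1)) by rewrite ge_min lexx orbT.
  rewrite ler_pdivlMr ?mulr_gt0 ?ltr_wpDl//; lra.
have hr2 : h <= r / 2 by rewrite ge_min lexx.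
pose eta := B1 * rate R n + B2 * h.
have eta0 : 0 <= eta by rewrite addr_ge0// mulr_ge0// ltW.
have eh : 0 < e / 8 * h by rewrite mulr_gt0.
have yh : y <= y + h by rewrite lerDl ltW.
have [M hM] := interval_mass_cvg yh eh.
(* Large enough to be compared with [n], to have its interval mass near the limit, and to make the
   counting error of the edges at most [e / 8 * h] after division by [m]. *)
pose m := maxn (maxn n M) (Num.truncn ((eta + `|c|) / (e / 8 * h))).+1.
have nm : (n <= m)%N by rewrite /m !leq_max leqnn.
have m0 : (0 < m)%N := leq_trans n0 nm.
have m0' : 0 < m%:R :> R by rewrite ltr0n.
have mbig : (eta + `|c|) <= m%:R * (e / 8 * h).
  rewrite -ler_pdivrMr//; apply: ltW; apply: lt_le_trans (truncnS_gt _) _.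
  by rewrite ler_nat /m leq_max leqnn orbT.
have {}hM := hM m (ltac:(by rewrite /m !leq_max leqnn orbT)).
have cnt := @interval_mass_count m y h c eta m0 (ltW h0) _ eta0.
have {}cnt : `|interval_mass m y (y + h) - h * c| <= h * eta + e / 8 * h.
  rewrite -(ler_pM2l m0') -[X in X * `|_|](ger0_norm (ltW m0')) -normrM mulrBr mulrA.
  apply: le_trans (cnt _) _; last by clear -mbig; lra.
  move=> x' /andP[x1 x2]; apply: le_trans (cmp n m x x' n0 nm) _.
  move: x1 x2; rewrite -/y; set z := (x'%:~R - _) / _ => x1 x2.
  by rewrite lerD2l; apply: ler_wpM2l => //; rewrite ger0_norm; lra.
have [] := andP (@itv_prob_bounds _ _ _ _ _ _ hf y (y + h) (f y - e / 8) (f y + e / 8) _ _).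
- by rewrite ltrDl.
- move=> z /andP[z1 z2]; have := hr z; rewrite ger0_norm; last by lra.
  move=> /(_ (ltac:(lra))); rewrite ler_norml => /andP[? ?]; apply/andP; split; lra.
have -> : y + h - y = h by ring.
(* Four errors of at most [e / 8] remain after division by [h]: drift, edges, convergence of the
   interval mass, and oscillation of [f]. *)
move=> hl hu; rewrite -(ler_pM2l h0) -[X in X * `|_|](ger0_norm (ltW h0)) -normrM mulrBr.
have hB' := ler_wpM2l (ltW h0) hB; have he := mulr_gt0 h0 e0.
move: cnt hM hl hu hB' he; rewrite /eta !ler_norml.
move: (interval_mass _ _ _) (itv_prob _ _ _) (f y) (B1 * _) => I p' fy S; clear.
move=> /andP[? ?] /andP[? ?] *; apply/andP; split; lra.
Qed.

Lemma rate_powR n : (0 < n)%N -> rate R n / n%:R = n%:R `^ (- 1 - 4^-1) :> R.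
Proof.
move=> n0; have n0' : 0 < n%:R :> R by rewrite ltr0n.
rewrite /rate -!powR12_sqrt ?invr_ge0 ?powR_ge0// -powRN -powRrM.
rewrite powRD ?lt0r_neq0 ?implybT// powRN powRr1 ?ltW// mulrC; congr (_ * powR _ _).
by field.
Qed.

End LocalLimit.

Theorem theorem1 (R : realType)
    (d : measure_display) (T : measurableType d) (P : probability T R)
    (Qn : nat -> {RV P >-> R})
    (d' : measure_display) (T' : measurableType d') (P' : probability T' R)
    (Q : {RV P' >-> R}) (f : R -> R)
    (hQn : quicksort_comparisons Qn)
    (hQ : cvg_in_distribution P
            (fun n w => (Qn n w - mean (Qn n)) / n%:R) Q)
    (hf : is_density Q f) (hfc : continuous f) :
  exists eps : R, 0 < eps /\
    exists C : R, forall (n : nat) (x : int), (1 <= n)%N ->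
      `| pmf (Qn n) x%:~R
         - n%:R^-1 * f ((x%:~R - mean (Qn n)) / n%:R) |
      <= C * n%:R `^ (- 1 - eps).
Proof.
(* The exponent is that of [rate]. *)
exists 4^-1; split; first by rewrite invr_gt0.
have [B hB] := local_limit_scaled hQn hQ hf hfc; exists B => n x n1.
rewrite (pmf_quicksort hQn) (mean_quicksort hQn) -rate_powR// mulrA.
have n0 : 0 < n%:R :> R by rewrite ltr0n.
rewrite ler_pdivlMr// mulrC -[X in X * `|_|](ger0_norm (ltW n0)) -normrM mulrBr.
by rewrite mulVKf ?lt0r_neq0//; exact: hB.
Qed.
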